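(* Let $(G,R)$ be an instance of \textsc{Directed Steiner Network}, let $g$ be the genus of $G$, let $T=V(R)$ and $q=|T|$, and let $H$ be an inclusion-minimal solution to $(G,R)$. Then the treewidth of (the underlying undirected graph of) $H$ is $O\!\left(20^{4(4g+3)}g\cdot q\right)$.
   Context: \textsc{Directed Steiner Network}: the input is a directed graph $G$ with positive arc weights and an unweighted directed graph $R$ with $V(R)\subseteq V(G)$. A subgraph $H$ of $G$ is a solution to $(G,R)$ if for every arc $st\in A(R)$ there is a directed path from $s$ to $t$ in $H$; it is an inclusion-minimal solution if it is a solution but $H-e$ is not a solution for every arc $e\in A(H)$. The genus of a directed graph means the genus of its underlying undirected graph, and treewidth of a directed graph means treewidth of its underlying undirected graph.
   Formalization: In the bound the factor g is replaced by max(g,1), since for planar G (g = 0) the bound as written is zero, which fails already when H is a single arc between two terminals. *)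

(* Defs.v *)
From mathcomp Require Import all_boot all_order all_fingroup.
Set Implicit Arguments. Unset Strict Implicit. Unset Printing Implicit Defensive.

Definition und_edge (V : finType) (a : rel V) : rel V :=
  fun u v => (u != v) && (a u v || a v u).

(** * Genus via rotation systems (Heffter--Edmonds). *)
Section Genus.
Variables (V : finType) (e : rel V).

Definition dart (d : V * V) : bool := e d.1 d.2.

Definition rotation_system (rho : {perm (V * V)}) : Prop :=
  [/\ forall d, ~~ dart d -> rho d = d,
      forall d, dart d -> dart (rho d) /\ (rho d).1 = d.1 &
      forall d d', dart d -> dart d' -> d.1 = d'.1 -> fconnect rho d d'].

Definition face_perm (rho : {perm (V * V)}) (d : V * V) : V * V := rho (d.2, d.1).

Definition num_faces (rho : {perm (V * V)}) : nat :=
  n_comp (frel (face_perm rho)) [pred d | dart d].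

Definition num_components : nat := n_comp e (@predT V).
Definition num_isolated : nat := #|[pred v : V | [forall u, ~~ e v u]]|.
Definition num_darts : nat := #|[pred d : V * V | dart d]|.   (* = 2 |E| *)

(* Euler genus of the embedding given by rho; per component
   V_i - E_i + F_i = 2 - 2 g_i (an isolated vertex being one face), written
   without subtraction and doubled:  4c + 2|E| = 2(|V| + F + I) + 4g. *)
Definition rotation_genus (rho : {perm (V * V)}) (g : nat) : Prop :=
  4 * num_components + num_darts = 2 * (#|V| + num_faces rho + num_isolated) + 4 * g.

Definition is_genus (g : nat) : Prop :=
  (exists2 rho, rotation_system rho & rotation_genus rho g) /\
  (forall rho g', rotation_system rho -> rotation_genus rho g' -> g <= g').
End Genus.

Definition is_tree (n : nat) (t : rel 'I_n) : Prop :=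
  [/\ 0 < n, symmetric t, irreflexive t,
      forall i j, connect t i j &
      #|[pred p : 'I_n * 'I_n | t p.1 p.2]| = 2 * (n - 1)].

Definition tree_decomposition (V : finType) (e : rel V)
    (n : nat) (t : rel 'I_n) (B : 'I_n -> {set V}) : Prop :=
  [/\ is_tree t,
      forall v, exists i, v \in B i,
      forall u v, e u v -> exists i, (u \in B i) && (v \in B i) &
      forall v i j, v \in B i -> v \in B j ->
        connect (fun x y => [&& t x y, v \in B x & v \in B y]) i j].

Definition treewidth_at_most (V : finType) (e : rel V) (k : nat) : Prop :=
  exists n (t : rel 'I_n) (B : 'I_n -> {set V}),
    tree_decomposition e t B /\ forall i, #|B i| <= k.+1.

(* H is given by its arc set A ⊆ V*V *)
Definition arc_rel (V : finType) (A : {set V * V}) : rel V := fun u v => (u, v) \in A.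

Definition is_solution (V : finType) (r : rel V) (A : {set V * V}) : Prop :=
  forall s t, r s t -> connect (arc_rel A) s t.

Definition inclusion_minimal_solution (V : finType) (a r : rel V) (A : {set V * V}) : Prop :=
  [/\ forall p, p \in A -> a p.1 p.2,
      is_solution r A &
      forall p, p \in A -> ~ is_solution r (A :\ p)].

(* Main.v *)
(** Call two vertices equivalent when they are joined by arcs of the solution
    whose ends are reached from the same terminals and reach the same terminals.
    Every arc [f] of a minimal solution is labelled by a pair (s, t) that it
    separates.  If two arcs entered the same class with the same [s], one of them
    could be bypassed; hence when a path of the solution enters a class along one
    arc, each further arc entering that class brings a new source, and dually for
    arcs leaving a class.  So the borders of the classes met by a directed path have
    total size O(q), and since in a shortest chain of directed paths and edges of G
    a terminal is related to boundedly many links, any two vertices in a component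
    of G are joined by a walk meeting O(q) border vertices.  The tree-cotree
    argument in an embedding of genus g then decomposes the borders with width
    O((g + 1) q).

    It remains to glue to this a decomposition of each class on its border.  A class
    is a directed path whose inner vertices have degree 2, or a strong component.  By
    minimality a strong component is any subgraph strongly connecting its border, and
    such a subgraph arises by adding the border vertices one at a time, with a path
    to the new vertex and a path back; these two form a ladder of width 2, and each
    step adds three vertices to the bags. *)

Require Import Defs.
From mathcomp Require Import all_boot all_order all_fingroup.
From mathcomp Require Import zify.
From Stdlib Require Import Classical.
Set Implicit Arguments. Unset Strict Implicit. Unset Printing Implicit Defensive.

(** * Walks and shortest paths *)

(** The bags of an embedding are made of root paths, and [G] has no bounded diameter; only the
    number of border vertices along a path can be controlled. Contracting the classes would mean
    leaving the given embedding, so contraction is simulated: every vertex of [G] is labelled with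
    the border of its class, bags collect labels instead of vertices, and the forest consists of
    paths that are shortest for a weight vanishing inside classes. A label occurs on a connected set
    of vertices, as a class is connected in [G], so the relabelled bags keep the connectivity axiom.
    A vertex meeting no arc of the solution is a class by itself, with a border only if it is a
    terminal. Edges of [G] outside the solution may join classes with unrelated signatures, where
    nothing telescopes; they are paid for by the terminals related to their ends, which is why
    chains of hops, and not single directed paths, are measured. *)

Lemma prop_least (P : nat -> Prop) :
  (exists n, P n) -> exists2 n, P n & forall m, P m -> n <= m.
Proof.
case=> n; elim/ltn_ind: n => n IHn Pn.
case: (classic (exists2 m, m < n & P m)) => [[m ltmn Pm]|noP]; first exact: IHn ltmn Pm.
exists n => // m Pm; rewrite leqNgt; apply/negP => ltmn; apply: noP; by exists m.
Qed.

Lemma connect_ind_r (T : finType) (e : rel T) (x : T) (P : T -> Prop) :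
  P x -> (forall y z, connect e x y -> P y -> e y z -> P z) ->
  forall y, connect e x y -> P y.
Proof.
move=> Px PS y /connectP[p + ->]; elim/last_ind: p => [|p z IHp] //=.
rewrite rcons_path last_rcons => /andP[pP ez].
by apply: PS ez; [apply/connectP; exists p | apply: IHp].
Qed.

Lemma connect_hom (T T' : finType) (e : rel T) (e' : rel T') (f : T -> T') :
  (forall x y, e x y -> connect e' (f x) (f y)) ->
  forall x y, connect e x y -> connect e' (f x) (f y).
Proof.
move=> ee' x y; elim/connect_ind_r: y / => [|y z _ IH yz]; first exact: connect0.
exact: connect_trans IH (ee' _ _ yz).
Qed.

Lemma connect_last (T : finType) (e : rel T) (x y : T) :
  connect e x y -> x != y -> exists2 z, connect e x z & e z y.
Proof.
move=> xy; suff [->|//] : x = y \/ exists2 z, connect e x z & e z y by rewrite eqxx.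
elim/connect_ind_r: y / xy => [|y z xy _ yz]; first by left.
by right; exists y.
Qed.

Section ShortestPaths.
Variables (V : finType) (e : rel V) (w : V -> V -> nat).

Inductive walk (x : V) : V -> nat -> nat -> Prop :=
| walk_nil : walk x x 0 0
| walk_rcons y z c n : walk x y c n -> e y z -> walk x z (c + w y z) n.+1.

Lemma walk_cat x y z c n c' n' :
  walk x y c n -> walk y z c' n' -> walk x z (c + c') (n + n').
Proof.
move=> xy yz; elim: yz => [|u v c1 n1 _ IH uv]; first by rewrite !addn0.
by rewrite addnA addnS; apply: walk_rcons.
Qed.

Lemma walk1 x y : e x y -> walk x y (w x y) 1.
Proof. by move=> xy; rewrite -[w x y]add0n; apply: walk_rcons xy; apply: walk_nil. Qed.

Lemma walk_inv x y c n : walk x y c n ->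
  y = x \/ exists u c' n', [/\ walk x u c' n', e u y, c = c' + w u y & n = n'.+1].
Proof. by case=> [|u v c' n' uP uv]; [left | right; exists u, c', n']. Qed.

Lemma walk_sym x y c n :
  symmetric e -> (forall u v, w u v = w v u) -> walk x y c n -> walk y x c n.
Proof.
move=> se sw; elim=> [|u v c1 n1 _ IH uv]; first exact: walk_nil.
rewrite addnC -add1n; apply: walk_cat IH; rewrite sw; apply: walk1; by rewrite se.
Qed.

Lemma connect_walk x y : connect e x y -> exists c n, walk x y c n.
Proof.
elim/connect_ind_r: y / => [|y z _ [c [n xy]] yz]; first by exists 0, 0; apply: walk_nil.
by exists (c + w y z), n.+1; apply: walk_rcons yz.
Qed.

(** Weights may vanish, so [cost] need not drop towards the root. [rank] is the least number of
    edges of a cheapest walk; it does drop, and it carries the later inductions along the forest. *)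
Lemma shortest_path_forest (rt : V -> V) :
  (forall v, connect e (rt v) v) -> (forall u v, e u v -> rt u = rt v) ->
  exists (par : V -> V) (cost : V -> nat) (rank : V -> nat),
    [/\ forall v, rt v = v -> par v = v,
        forall v, rt v != v ->
          [/\ e (par v) v, rank (par v) < rank v & cost v = cost (par v) + w (par v) v],
        forall v, rt v = v -> cost v = 0 &
        forall v c n, walk (rt v) v c n -> cost v <= c].
Proof.
move=> rtP rtE.
have /fin_all_exists[cost costP] v : exists c, (exists n, walk (rt v) v c n) /\
    forall c' n, walk (rt v) v c' n -> c <= c'.
  have [c [n vn]] := connect_walk (rtP v).
  have [|c0 [n0 c0P] c0m] := @prop_least (fun c => exists n, walk (rt v) v c n).
    by exists c, n.
  exists c0; split; first by exists n0.
  by move=> c' n' c'P; apply: c0m; exists n'.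
have /fin_all_exists[rank rankP] v : exists n, walk (rt v) v (cost v) n /\
    forall n', walk (rt v) v (cost v) n' -> n <= n'.
  have [ex _] := costP v; have [n0 n0P n0m] := prop_least ex.
  by exists n0.
have rtrt v : rt (rt v) = rt v.
  suff rtc x y : connect e x y -> rt x = rt y by apply: rtc.
  by elim/connect_ind_r: y / => // y z _ -> /rtE.
have cost0 v : rt v = v -> cost v = 0.
  move=> rv; apply/eqP; rewrite -leqn0; have [_ cm] := costP v.
  by apply: (cm _ 0); rewrite rv; apply: walk_nil.
have /fin_all_exists[par parP] v : exists u, (rt v = v -> u = v) /\
    (rt v != v -> [/\ e u v, rank u < rank v & cost v = cost u + w u v]).
  have [rv|rv] := eqVneq (rt v) v; first by exists v.
  have [rk _] := rankP v; have [_ cm] := costP v.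
  case: (walk_inv rk) => [vr|[u [c [n [uP uv Ec En]]]]]; first by rewrite -vr eqxx in rv.
  have ru : rt u = rt v by apply: rtE.
  exists u; split; first by move=> vr; rewrite vr eqxx in rv.
  move=> _; have [[k kP] um] := costP u.
  have ltu : cost u = c.
    apply/eqP; rewrite eqn_leq (um _ n) ?ru //= -(leq_add2r (w u v)) -Ec.
    by apply: (cm _ k.+1); rewrite -ru; apply: walk_rcons.
  split=> //; last by rewrite ltu.
  have [_ rm] := rankP u; rewrite En ltnS; apply: rm.
  by rewrite ltu ru.
exists par, cost, rank; split=> //.
- by move=> v; case: (parP v).
- by move=> v; case: (parP v).
- by move=> v c n; case: (costP v) => _; apply.
Qed.

End ShortestPaths.

(** * Tree decompositions *)

Definition links (N : finType) (l : {set N * N}) : rel N :=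
  fun i j => ((i, j) \in l) || ((j, i) \in l).

Lemma links_sym (N : finType) (l : {set N * N}) : symmetric (links l).
Proof. by move=> i j; rewrite /links orbC. Qed.

Lemma spanning_tree (N : finType) (e : rel N) (r : N) :
  (forall i, connect e r i) ->
  exists (par : N -> N) (rank : N -> nat),
    forall i, i != r -> e (par i) i /\ rank (par i) < rank i.
Proof.
move=> re.
have [//|//|par [cost [rank [_ parP _ _]]]] :=
  @shortest_path_forest N e (fun _ _ => 0) (fun _ => r).
by exists par, rank => i; rewrite eq_sym => /parP[].
Qed.

(** Each link gives at most two ordered pairs. Conversely, the pairs of a spanning tree and their
    reversals are disjoint because [rank] drops towards the root. *)
Lemma tree_card (N : finType) (l : {set N * N}) :
  #|l| < #|N| -> (forall i j, connect (links l) i j) ->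
  #|[pred p : N * N | links l p.1 p.2 && (p.1 != p.2)]| = 2 * (#|N| - 1).
Proof.
move=> ltlN lc; have /card_gt0P[r _] : 0 < #|N| by lia.
have [par [rank parP]] := spanning_tree (lc r).
have parI i : i != r -> par i != i.
  by move=> /parP[_]; apply: contraTneq => ->; rewrite ltnn.
apply/eqP; rewrite eqn_leq; apply/andP; split.
  have sub : [pred p : N * N | links l p.1 p.2 && (p.1 != p.2)] \subset
      l :|: [set (p.2, p.1) | p in l].
    apply/subsetP => -[i j]; rewrite !inE /links /= => /andP[/orP[->//|ji] _].
    by apply/orP; right; apply/imsetP; exists (j, i).
  apply: leq_trans (subset_leq_card sub) (leq_trans (leq_card_setU _ _) _).
  apply: leq_trans (leq_add (leqnn _) (leq_imset_card _ _)) _.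
  have ar a n : a < n -> a + a <= 2 * (n - 1) by lia.
  exact: ar.
have sub : [set (i, par i) | i in [set~ r]] :|: [set (par i, i) | i in [set~ r]]
    \subset [pred p : N * N | links l p.1 p.2 && (p.1 != p.2)].
  apply/subsetP => -[i j]; rewrite inE => /orP[] /imsetP[k]; rewrite !inE => kr [-> ->] /=.
    by rewrite links_sym eq_sym parI // andbT; case: (parP _ kr).
  by rewrite parI // andbT; case: (parP _ kr).
apply: leq_trans (subset_leq_card sub).
apply: (@leq_trans (#|[set (i, par i) | i in [set~ r]]| + #|[set (par i, i) | i in [set~ r]]|)).
  rewrite !card_in_imset ?cardsC1; try by move=> i j _ _ [].
  by have ar n : 2 * (n - 1) <= n.-1 + n.-1 by lia; apply: ar.
rewrite cardsU leq_eqVlt; apply/orP; left.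
suff -> : [set (i, par i) | i in [set~ r]] :&: [set (par i, i) | i in [set~ r]] = set0.
  by rewrite cards0 subn0.
apply/eqP; rewrite -subset0; apply/subsetP => -[i j]; rewrite inE.
case/andP=> /imsetP[k]; rewrite !inE => kr [-> ->] /imsetP[k']; rewrite !inE => k'r [E1 E2].
by have [_] := parP _ kr; have [_] := parP _ k'r; rewrite -E1 E2; lia.
Qed.

Section Decompositions.
Variable V : finType.
Implicit Types (U S X : {set V}) (F : {set V} -> Prop).

(* The node graph is a tree when [m = 0]; [F] lists the sets to be contained in
   some bag, so edges and boundary cliques are treated alike. *)
Definition gdec (m k : nat) (U : {set V}) (F : {set V} -> Prop) : Prop :=
  exists (N : finType) (l : {set N * N}) (B : N -> {set V}),
   [/\ #|l| < #|N| + m,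
       forall i j, connect (links l) i j,
       forall v i j, v \in B i -> v \in B j ->
          connect (fun x y => [&& links l x y, v \in B x & v \in B y]) i j,
       forall S, F S -> exists i, S \subset B i &
       forall i, (#|B i| <= k) && (B i \subset U)].

Definition tdec := gdec 0.

Lemma gdec_weaken m k k' U U' F F' :
  k <= k' -> U \subset U' -> (forall S, F' S -> exists2 S', F S' & S \subset S') ->
  gdec m k U F -> gdec m k' U' F'.
Proof.
move=> lek sU FF' [N [l [B [ln lc vc FB Bk]]]].
exists N, l, B; split=> // [S /FF'[S' /FB[i S'i] SS']|i].
  by exists i; apply: subset_trans S'i.
by case/andP: (Bk i) => Bi BU; rewrite (leq_trans Bi lek) (subset_trans BU sU).
Qed.

Lemma tdec_bag k U S : #|S| <= k -> S \subset U -> tdec k U (fun S' => S' \subset S).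
Proof.
move=> Sk SU; exists unit, set0, (fun=> S); split.
- by rewrite cards0 card_unit.
- by case=> -[]; apply: connect0.
- by move=> v [] [] _ _; apply: connect0.
- by move=> S' S'S; exists tt.
- by move=> _; apply/andP.
Qed.

Lemma gdec_add m k U F X : gdec m k U F ->
  gdec m (k + #|X|) (U :|: X) (fun S => exists2 S', F S' & S \subset S' :|: X).
Proof.
case=> [N [l [B [ln lc vc FB Bk]]]]; exists N, l, (fun i => B i :|: X).
split=> // [v i j|S [S' /FB[i S'i] SS']|i].
- have [vX _ _|vX] := boolP (v \in X).
    rewrite (@eq_connect _ _ (links l)) //.
    by move=> x y; rewrite /= !inE vX !orbT !andbT.
  rewrite !inE (negPf vX) !orbF => vi vj.
  rewrite (@eq_connect _ _ (fun x y => [&& links l x y, v \in B x & v \in B y])).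
    exact: vc.
  by move=> x y; rewrite /= !inE (negPf vX) !orbF.
- by exists i; apply: subset_trans SS' _; apply: setSU.
- case/andP: (Bk i) => Bi BU; rewrite setSU // andbT.
  by apply: leq_trans (leq_card_setU _ _) _; rewrite leq_add2r.
Qed.

(** One new link suffices, between a bag holding [S1] and a bag holding [S2]: a vertex of both sides
    lies in both of these bags. *)
Lemma tdec_glue k U1 U2 F1 F2 S1 S2 :
  tdec k U1 F1 -> tdec k U2 F2 -> F1 S1 -> F2 S2 ->
  U1 :&: U2 \subset S1 -> U1 :&: U2 \subset S2 ->
  tdec k (U1 :|: U2) (fun S => F1 S \/ F2 S).
Proof.
case=> [N1 [l1 [B1 [ln1 lc1 vc1 FB1 Bk1]]]] [N2 [l2 [B2 [ln2 lc2 vc2 FB2 Bk2]]]].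
move=> /FB1[i1 Si1] /FB2[i2 Si2] US1 US2.
pose N := (N1 + N2)%type.
pose f1 (p : N1 * N1) : N * N := (inl p.1, inl p.2).
pose f2 (p : N2 * N2) : N * N := (inr p.1, inr p.2).
pose l : {set N * N} := (inl i1, inr i2) |: (f1 @: l1 :|: f2 @: l2).
pose B (x : N) := match x with inl i => B1 i | inr i => B2 i end.
have ll1 i j : links l1 i j -> links l (inl i) (inl j).
  rewrite /links => /orP[] ij; apply/orP; [left|right]; rewrite !inE;
  by apply/orP; right; apply/orP; left; apply/imsetP; eexists; first exact: ij.
have ll2 i j : links l2 i j -> links l (inr i) (inr j).
  rewrite /links => /orP[] ij; apply/orP; [left|right]; rewrite !inE;
  by apply/orP; right; apply/orP; right; apply/imsetP; eexists; first exact: ij.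
have l12 : links l (inl i1) (inr i2) by rewrite /links !inE eqxx.
have lsym := links_sym l.
exists N, l, B; split.
- rewrite addn0 card_sum.
  have lc : #|l| <= 1 + (#|l1| + #|l2|).
    apply: leq_trans (leq_card_setU _ _) _; rewrite cards1 leq_add2l.
    by apply: leq_trans (leq_card_setU _ _) (leq_add _ _); apply: leq_imset_card.
  have ar x a b n1 n2 : a < n1 + 0 -> b < n2 + 0 -> x <= 1 + (a + b) -> x < n1 + n2 by lia.
  exact: ar ln1 ln2 lc.
- have c1 i j : connect (links l) (inl i) (inl j).
    by apply: (connect_hom (e := links l1)) (lc1 i j) => x y xy; apply/connect1/ll1.
  have c2 i j : connect (links l) (inr i) (inr j).
    by apply: (connect_hom (e := links l2)) (lc2 i j) => x y xy; apply/connect1/ll2.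
  have c12 i j : connect (links l) (inl i) (inr j).
    by apply: connect_trans (c1 i i1) (connect_trans (connect1 l12) (c2 i2 j)).
  move=> [i|i] [j|j] //; by rewrite (sym_connect_sym lsym).
- move=> v.
  set e := fun x y => [&& links l x y, v \in B x & v \in B y].
  have esym : symmetric e by move=> x y; rewrite /e lsym [(v \in B x) && _]andbC.
  have c1 i j : v \in B1 i -> v \in B1 j -> connect e (inl i) (inl j).
    move=> vi vj; apply: connect_hom (vc1 _ _ _ vi vj) => x y /and3P[xy vx vy].
    by apply: connect1; rewrite /e ll1 //= vx.
  have c2 i j : v \in B2 i -> v \in B2 j -> connect e (inr i) (inr j).
    move=> vi vj; apply: connect_hom (vc2 _ _ _ vi vj) => x y /and3P[xy vx vy].
    by apply: connect1; rewrite /e ll2 //= vx.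
  have c12 i j : v \in B1 i -> v \in B2 j -> connect e (inl i) (inr j).
    move=> vi vj; have vU : v \in U1 :&: U2.
      case/andP: (Bk1 i) => _ /subsetP/(_ _ vi); case/andP: (Bk2 j) => _ /subsetP/(_ _ vj).
      by rewrite inE => -> ->.
    have v1 : v \in B1 i1 by apply: (subsetP Si1); apply: (subsetP US1).
    have v2 : v \in B2 i2 by apply: (subsetP Si2); apply: (subsetP US2).
    apply: connect_trans (c1 _ _ vi v1) (connect_trans _ (c2 _ _ v2 vj)).
    by apply: connect1; rewrite /e l12 /= v1.
  move=> [i|i] [j|j] /=; [exact: c1|exact: c12| |exact: c2].
  by move=> vi vj; rewrite (sym_connect_sym esym); apply: c12.
- by move=> S [/FB1[i Si]|/FB2[i Si]]; [exists (inl i)|exists (inr i)].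
- move=> [i|i] /=; [case/andP: (Bk1 i)|case/andP: (Bk2 i)] => -> /= BU;
  apply: subset_trans BU _; [exact: subsetUl|exact: subsetUr].
Qed.

(** Keep a spanning tree of the node graph; at most [m] links are dropped. Adding to every bag the
    vertices shared by the ends of a dropped link repairs connectivity at the price of [k] per
    link. *)
Lemma gdec_tdec m k U F : gdec m k U F -> tdec (k * m.+1) U F.
Proof.
case=> [N [l [B [ln lc vc FB Bk]]]].
have [N0|/card_gt0P[r _]] := posnP #|N|.
  have noN : N -> False by move=> i; have := fintype0 i N0.
  exists unit, set0, (fun=> set0); split=> //.
  - by rewrite cards0 card_unit.
  - by case=> -[]; apply: connect0.
  - by move=> v i j; rewrite inE.
  - by move=> S /FB[i]; case: (noN i).
  - by move=> _; rewrite cards0 sub0set.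
have [par [rank parP]] := spanning_tree (lc r).
(* The orientation in which the tree link occurs in [l], so that [l0] is a subset of [l] and can be
   subtracted from it. *)
pose f i := if (i, par i) \in l then (i, par i) else (par i, i).
pose l0 := f @: [set~ r].
have l0l : l0 \subset l.
  apply/subsetP => p /imsetP[i]; rewrite !inE => /parP[+ _] ->.
  by rewrite /links /f; case: ifP => // _ /orP[] // ->.
have fI : {in [set~ r] &, injective f}.
  move=> i j; rewrite !inE => /parP[_ ri] /parP[_ rj]; rewrite /f.
  by case: ifP => _; case: ifP => _ [E1 E2] //; move: ri rj;
    [rewrite E2 -E1 | rewrite E1 -E2]; lia.
have l0c : #|l0| = #|N|.-1 by rewrite card_in_imset // cardsC1.
have Npos : 0 < #|N| by apply/card_gt0P; exists r.
have ldc : #|l :\: l0| <= m by rewrite cardsD (setIidPr l0l) l0c; lia.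
pose X := \bigcup_(p in l :\: l0) (B p.1 :&: B p.2).
have Xc : #|X| <= m * k.
  apply: leq_trans (_ : \sum_(p in l :\: l0) k <= _); last first.
    by rewrite sum_nat_const leq_mul2r ldc orbT.
  rewrite /X; elim/big_rec2: _ => [|p n S _ IH]; first by rewrite cards0.
  apply: leq_trans (leq_card_setU _ _) _; rewrite leq_add //.
  by apply: leq_trans (subset_leq_card (subsetIl _ _)) _; case/andP: (Bk p.1).
have conn0 i : connect (links l0) r i.
  move En: (rank i) => n; elim/ltn_ind: n i En => n IHn i En.
  have [->//|ir] := eqVneq i r.
  have [_ rk] := parP _ ir; apply: connect_trans (IHn (rank (par i)) _ (par i) erefl) _.
    by rewrite -En.
  apply: connect1; rewrite /links; apply/orP.
  have : f i \in l0 by apply: imset_f; rewrite !inE.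
  by rewrite /f; case: ifP => _ ->; [right|left].
have l0sym := links_sym l0.
exists N, l0, (fun i => B i :|: X); split.
- by rewrite l0c; lia.
- by move=> i j; apply: connect_trans (conn0 j); rewrite (sym_connect_sym l0sym).
- move=> v i j; have [vX _ _|vX] := boolP (v \in X).
    rewrite (@eq_connect _ _ (links l0)).
      by apply: connect_trans (conn0 j); rewrite (sym_connect_sym l0sym).
    by move=> x y; rewrite /= !inE vX !orbT !andbT.
  rewrite !inE (negPf vX) !orbF => vi vj.
  apply: connect_sub (vc _ _ _ vi vj) => x y /and3P[xy vx vy].
  apply: connect1; rewrite !inE vx vy !andbT.
  have key p : p \in l -> v \in B p.1 -> v \in B p.2 -> p \in l0.
    move=> pl v1 v2; apply: contraNT vX => pl0.
    by apply/bigcupP; exists p; rewrite inE ?pl0 ?v1.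
  by case/orP: xy => xy; rewrite /links (key _ xy) ?orbT.
- by move=> S /FB[i Si]; exists i; apply: subset_trans Si (subsetUl _ _).
- move=> i; case/andP: (Bk i) => Bi BU; apply/andP; split.
    by apply: leq_trans (leq_card_setU _ _) _; rewrite mulnS leq_add // mulnC.
  rewrite subUset BU; apply/bigcupsP => p _.
  by apply: subset_trans (subsetIl _ _) _; case/andP: (Bk p.1).
Qed.

(** A tree decomposition must cover every vertex, while [tdec] only covers the listed sets; a vertex
    in none of them gets a bag of its own. *)
Lemma tdec_singletons k U F : tdec k.+1 U F ->
  tdec k.+1 setT (fun S => F S \/ exists v, S = [set v]).
Proof.
move=> dU.
suff [U' dU'] : exists U',
    tdec k.+1 U' (fun S => F S \/ exists2 v, S = [set v] & v \in enum V).
  apply: gdec_weaken dU' => // S [FS|[v ->]]; first by exists S => //; left.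
  by exists [set v] => //; right; exists v => //; rewrite mem_enum.
elim: (enum V) => [|v s [U' dU']].
  exists U; apply: gdec_weaken dU => // S [FS|[v _]]; last by rewrite in_nil.
  by exists S.
have [|nov] := classic (exists2 S, F S \/ (exists2 v0, S = [set v0] & v0 \in s) & v \in S).
  case=> S0 FS0 vS0; exists U'; apply: gdec_weaken dU' => //.
  move=> S [FS|[v' ->]]; first by exists S => //; left.
  rewrite inE => /orP[/eqP->|v's]; first by exists S0; rewrite ?sub1set.
  by exists [set v'] => //; right; exists v'.
(* As [v] lies in no listed set, it can be dropped from all bags. *)
have dUv : tdec k.+1 (U' :\ v) (fun S => F S \/ (exists2 v0, S = [set v0] & v0 \in s)).
  case: dU' => [N [l [B [ln lc vc FB Bk]]]]; exists N, l, (fun i => B i :\ v); split=> //.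
  - move=> v' i j; rewrite !inE => /andP[v'v vi] /andP[_ vj].
    apply: connect_sub (vc _ _ _ vi vj) => x y /and3P[xy vx vy].
    by apply: connect1; rewrite !inE xy v'v vx vy.
  - move=> S FS; have [i Si] := FB S FS; exists i; apply/subsetP => x xS.
    rewrite !inE (subsetP Si) // andbT; apply: contraPneq (xS) => -> vS.
    by apply: nov; exists S.
  - move=> i; case/andP: (Bk i) => Bi BU; rewrite setSD // andbT.
    by apply: leq_trans (subset_leq_card (subsetDl _ _)) Bi.
have dv : tdec k.+1 [set v] (fun S' => S' \subset [set v]).
  by apply: tdec_bag; rewrite ?cards1.
have [|noF] := classic (exists S, F S \/ (exists2 v0, S = [set v0] & v0 \in s)).
  case=> S0 FS0; exists (U' :\ v :|: [set v]).
  have := @tdec_glue _ _ _ _ _ S0 [set v] dUv dv FS0 (subxx _).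
  have -> : (U' :\ v) :&: [set v] = set0.
    by apply/setP => x; rewrite !inE; case: eqP => //= _; rewrite andbF.
  rewrite !sub0set => /(_ isT isT); apply: gdec_weaken => // S [FS|[v' ->]].
    by exists S => //; left; left.
  rewrite inE => /orP[/eqP->|v's]; first by exists [set v] => //; right.
  by exists [set v'] => //; left; right; exists v'.
exists [set v]; apply: gdec_weaken dv => // S [FS|[v' ->]].
  by case: noF; exists S; left.
rewrite inE => /orP[/eqP->|v's]; first by exists [set v].
by case: noF; exists [set v']; right; exists v'.
Qed.

(** Nodes are transferred to ordinals by enumeration, and loops among the links are discarded, since
    [is_tree] asks for an irreflexive relation. *)
Lemma tdec_treewidth k U F (e : rel V) :
  tdec k.+1 U F -> (forall u v, e u v -> exists2 S, F S & [set u; v] \subset S) ->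
  treewidth_at_most e k.
Proof.
move=> /tdec_singletons[N [l [B [ln lc vc FB Bk]]]] eF; rewrite addn0 in ln.
pose t : rel 'I_#|N| := fun i j => links l (enum_val i) (enum_val j) && (i != j).
have hom (e1 : rel N) (e2 : rel 'I_#|N|) x y :
    (forall i j : 'I_#|N|, i != j -> e1 (enum_val i) (enum_val j) -> e2 i j) ->
    connect e1 (enum_val x) (enum_val y) -> connect e2 x y.
  move=> e12 xy; rewrite -(enum_valK x) -(enum_valK y); apply: connect_hom xy => i j ij.
  have [->//|nij] := eqVneq i j; apply: connect1; apply: e12.
    by rewrite (inj_eq enum_rank_inj).
  by rewrite !enum_rankK.
exists #|N|, t, (fun i => B (enum_val i)); split; last first.
  by move=> i; case/andP: (Bk (enum_val i)).
split.
- split.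
  + by lia.
  + by move=> i j; rewrite /t links_sym eq_sym.
  + by move=> i; rewrite /t eqxx andbF.
  + by move=> i j; apply: hom (lc _ _) => x y xy lxy; rewrite /t lxy.
  + rewrite -(tree_card ln lc).
    pose f (p : 'I_#|N| * 'I_#|N|) : N * N := (enum_val p.1, enum_val p.2).
    have fI : injective f.
      by move=> [a b] [c d] [/enum_val_inj-> /enum_val_inj->].
    rewrite -(card_imset _ fI); apply: eq_card => -[x y]; apply/imsetP/idP.
      case=> -[i j] ij [-> ->]; move: ij; rewrite !inE /t /=.
      by rewrite (inj_eq enum_val_inj).
    rewrite inE /= => xy; exists (enum_rank x, enum_rank y); last by rewrite /f /= !enum_rankK.
    by rewrite inE /t /= !enum_rankK (inj_eq enum_rank_inj).
- move=> v; have [|i] := FB [set v]; first by right; exists v.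
  by rewrite sub1set => vi; exists (enum_rank i); rewrite enum_rankK.
- move=> u v /eF[S FS uvS]; have [|i Si] := FB S; first by left.
  exists (enum_rank i); rewrite enum_rankK.
  by have := subset_trans uvS Si; rewrite subUset !sub1set.
- move=> v i j vi vj; apply: hom (vc _ _ _ vi vj) => x y xy /and3P[lxy vx vy].
  by rewrite /t lxy xy vx vy.
Qed.

End Decompositions.

(** * Decompositions from embeddings *)

(** A cycle cut at one place is a path: start at [f p] and iterate until [p] comes back. It serves
    for faces opened at their root and for rotations lacking the step at the parent dart. *)
Lemma orbit_gap (T : finType) (f : T -> T) (R : T -> T -> Prop) (p : T) :
  injective f ->
  (forall x, R x x) -> (forall x y, R x y -> R y x) ->
  (forall x y z, R x y -> R y z -> R x z) ->
  (forall x, fconnect f p x -> x != p -> R x (f x)) ->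
  forall x y, fconnect f p x -> fconnect f p y -> R x y.
Proof.
move=> fI Rr Rs Rt Rf.
suff H x : fconnect f p x -> R (f p) x by move=> x y /H px /H py; apply: Rt py; apply: Rs.
have it k : k < fingraph.order f p -> R (f p) (iter k.+1 f p).
  elim: k => [|k IHk] lk; first exact: Rr.
  apply: (Rt _ _ _ (IHk (ltnW lk))); apply: Rf; first exact: fconnect_iter.
  apply/eqP => E; have := findex_iter lk; rewrite E findex0; lia.
move=> px; rewrite -(iter_findex px).
have := findex_max px; case: (findex f p x) => [|k] lk; last exact/it/ltnW.
by have := it (fingraph.order f p).-1; rewrite prednK ?order_gt0 // => /(_ (leqnn _)); rewrite iter_order.
Qed.

Definition ancestors (V : finType) (par : V -> V) (u : V) : {set V} :=
  [set x | fconnect par u x].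

Section Embedding.
Variables (V : finType) (e : rel V) (g : nat) (rho : {perm (V * V)}).
Hypotheses (e_sym : symmetric e) (e_irr : irreflexive e).
Hypothesis rhoP : rotation_system e rho.
Variables (par : V -> V) (rank : V -> nat).
Hypothesis par_root : forall v, root e v = v -> par v = v.
Hypothesis parP : forall v, root e v != v -> e (par v) v /\ rank (par v) < rank v.

Let swap (d : V * V) := (d.2, d.1).
Let phi := face_perm rho.
Let R := ancestors par.
Let isol v := [forall u, ~~ e v u].
Let dart := Defs.dart e.

Let c_sym : connect_sym e. Proof. exact: sym_connect_sym. Qed.

Let phi_inj : injective phi.
Proof. by move=> [a b] [c d] /perm_inj [-> ->]. Qed.

Let phi_dart d : dart d -> dart (phi d) /\ (phi d).1 = d.2.
Proof.
by move=> dd; case: rhoP => _ /(_ (swap d)) + _; apply; rewrite /Defs.dart /= e_sym.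
Qed.

Let rho_dart d : dart d -> dart (rho d) /\ (rho d).1 = d.1.
Proof. by case: rhoP => _ + _; apply. Qed.

Let base d := froot phi d.

Let base_conn d : fconnect phi d (base d). Proof. exact: connect_root. Qed.

Let fconnect_dart d d' : fconnect phi d d' -> dart d -> dart d'.
Proof.
move=> + dd; elim/connect_ind_r: d' / => // y z _ dy /eqP<-.
by case: (phi_dart dy).
Qed.

Let base_dart d : dart d -> dart (base d).
Proof. exact/fconnect_dart/base_conn. Qed.

Let base_eq d d' : fconnect phi d d' -> base d = base d'.
Proof. by move/(rootP (fconnect_sym phi_inj)). Qed.

Let tree d := (root e d.1 != d.1) && (d.2 == par d.1) || (root e d.2 != d.2) && (d.1 == par d.2).

(* Nodes are the darts and a hub [None]; pairs that are not darts and isolated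
   vertices hang on the hub.  The links are the faces, each opened at its root,
   the edges outside the forest, and one link from the hub to each component, so
   that Euler's formula counts [2 * g] links more than a tree has. *)
Let N := option (V * V).
(** As if each face were triangulated by a fan from the tail of its base: a dart and that apex span
    a triangle, and the bag holds the three root paths of its corners. *)
Let B (i : N) : {set V} :=
  if i is Some d then
    if dart d then R d.1 :|: R d.2 :|: R (base d).1
    else if (d.1 == d.2) && isol d.1 then R d.1 else set0
  else set0.

(** The default is taken only at isolated vertices, which [S4] excludes. *)
Let hd v := (v, odflt v [pick u | e v u]).
Let S1 := [set d | dart d && (phi d != base d)].
Let S2 := [set d | [&& dart d, ~~ tree d & enum_rank d.1 < enum_rank d.2]].
Let S3 := [set d | ~~ dart d].
Let S4 := [set v | (root e v == v) && ~~ isol v].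
Let f1 d : N * N := (Some d, Some (phi d)).
Let f2 d : N * N := (Some d, Some (swap d)).
Let f3 d : N * N := (None, Some d).
Let f4 v : N * N := (None, Some (hd v)).
Let l : {set N * N} := f1 @: S1 :|: f2 @: S2 :|: f3 @: S3 :|: f4 @: S4.

Let l1 d : dart d -> phi d != base d -> links l (Some d) (Some (phi d)).
Proof.
by move=> dd pd; rewrite /links !in_setU [_ \in f1 @: S1]imset_f // /S1 inE dd.
Qed.

Let l2 d : dart d -> ~~ tree d -> links l (Some d) (Some (swap d)).
Proof.
move=> dd td; rewrite /links !in_setU.
have [lt|] := ltnP (enum_rank d.1) (enum_rank d.2).
  by rewrite [_ \in f2 @: S2]imset_f ?orbT // /S2 inE dd td.
rewrite leq_eqVlt => /orP[/eqP E|lt].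
  by move: dd; rewrite /dart /Defs.dart (enum_rank_inj (ord_inj E)) e_irr.
apply/orP; right; do 2![apply/orP; left]; apply/orP; right.
apply/imsetP; exists (swap d); last by case: d {dd td lt}.
by rewrite inE /dart /Defs.dart /= e_sym lt andbT [e _ _]dd /tree orbC.
Qed.

Let l3 d : ~~ dart d -> links l None (Some d).
Proof.
by move=> dd; rewrite /links !in_setU [_ \in f3 @: S3]imset_f ?orbT // /S3 inE.
Qed.

Let l4 v : root e v = v -> ~~ isol v -> links l None (Some (hd v)).
Proof.
by move=> rv iv; rewrite /links !in_setU [_ \in f4 @: S4]imset_f ?orbT // /S4 inE rv eqxx.
Qed.

Let hd_dart v : ~~ isol v -> dart (hd v).
Proof.
rewrite /hd /dart /Defs.dart /=; case: pickP => //= nov /negP[].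
by apply/forallP => u; rewrite nov.
Qed.

Let dart_nisol d : dart d -> ~~ isol d.1.
Proof. by move=> dd; apply/negP => /forallP/(_ d.2); rewrite [e _ _]dd. Qed.

Let R_refl u : u \in R u. Proof. rewrite /R /ancestors. by rewrite inE connect0. Qed.

Let R_par u x : x \in R (par u) -> x \in R u.
Proof. by rewrite /R /ancestors !inE => ux; apply: connect_trans ux; apply: fconnect1. Qed.

Let R_root u x : root e u = u -> x \in R u -> x = u.
Proof.
move=> /par_root pu; rewrite /R /ancestors inE => /iter_findex<-.
by elim: (findex par u x) => //= n ->.
Qed.

Let R_inv u x : x \in R u -> x = u \/ root e u != u /\ x \in R (par u).
Proof.
have [ru|ru] := eqVneq (root e u) u; first by left; apply: R_root.
rewrite /R /ancestors !inE => /connectP[[|y p] /= pP ->]; first by left.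
by case/andP: pP => /eqP<- pP; right; split=> //; apply/connectP; exists p.
Qed.

(** * Connectivity of the bags that contain a fixed vertex *)

Section Vertex.
Variable x : V.
Let ex i j := [&& links l i j, x \in B i & x \in B j].
Let Rc d d' := connect ex (Some d) (Some d').

Let ex_sym : symmetric ex.
Proof. by move=> i j; rewrite /ex links_sym [(x \in B i) && _]andbC. Qed.

Let Rc_refl d : Rc d d. Proof. exact: connect0. Qed.
Let Rc_sym d d' : Rc d d' -> Rc d' d.
Proof. by rewrite /Rc (sym_connect_sym ex_sym). Qed.
Let Rc_trans d1 d2 d3 : Rc d1 d2 -> Rc d2 d3 -> Rc d1 d3.
Proof. exact: connect_trans. Qed.

Let inB d u : dart d -> x \in R u -> (u == d.1) || (u == d.2) || (u == (base d).1) ->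
  x \in B (Some d).
Proof.
by move=> dd xu H; rewrite /= dd !in_setU; case/orP: H => [/orP[]|] /eqP<-; rewrite xu ?orbT.
Qed.

(** All bags of a face contain the ancestors of its apex, so the face stays connected although it is
    opened just before its base. *)
Let face_conn d d' : dart d -> x \in R (base d).1 -> fconnect phi d d' -> Rc d d'.
Proof.
move=> dd xb dd'.
have ep : phi (finv phi (base d)) = base d by apply: f_finv.
have pd : fconnect phi (finv phi (base d)) d.
  apply: (connect_trans (fconnect1 _ _)); rewrite ep fconnect_sym //; exact: base_conn.
apply: (@orbit_gap _ phi Rc (finv phi (base d))) => //; last exact: connect_trans pd dd'.
move=> d1 pd1 nd1.
have dd1 : fconnect phi d d1 by apply: connect_trans pd1; rewrite fconnect_sym.
have d1d : dart d1 := fconnect_dart dd1 dd.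
have b1 : base d1 = base d by rewrite (base_eq dd1).
have b2 : base (phi d1) = base d by rewrite -b1; apply/esym/base_eq/fconnect1.
apply: connect1; rewrite /ex l1 //=; last first.
  by rewrite b1 -ep (inj_eq phi_inj).
apply/andP; split; apply: (@inB _ (base d).1) => //; rewrite ?b1 ?b2 ?eqxx ?orbT //.
by case: (phi_dart d1d).
Qed.

(** The bags of [d] and [phi d] share the ancestors of [d.2]. If the link between them is the one
    removed, then [d.2] is the apex and one goes round the face instead. *)
Let target_conn d : dart d -> x \in R d.2 -> Rc d (phi d).
Proof.
move=> dd xd; have [pd ps] := phi_dart dd.
have [E|E] := eqVneq (phi d) (base d).
  by apply: face_conn => //; rewrite -?E ?ps // fconnect1.
apply: connect1; rewrite /ex l1 //=; apply/andP; split.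
  by apply: (@inB _ d.2) => //; rewrite eqxx !orbT.
by apply: (@inB _ d.2) => //; rewrite ps eqxx.
Qed.

(* Going around [u], only the link across the parent edge is missing: across a
   child edge one goes around the subtree of the child. *)
Let vertex_conn u d d' : x \in R u -> dart d -> dart d' -> d.1 = u -> d'.1 = u -> Rc d d'.
Proof.
(* Children have larger rank, so the induction runs from the leaves upwards, on [M - rank u]. *)
pose M := \max_v rank v; have leM v : rank v <= M by apply: leq_bigmax.
move En: (M - rank u) => n; elim/ltn_ind: n u En d d' => n IHn u En d d' xu dd dd' du du'.
have step d1 : dart d1 -> d1.1 = u -> (root e u == u) || (d1.2 != par u) -> Rc d1 (rho d1).
  move=> dd1 d1u H.
  have sd1 : dart (swap d1) by rewrite /dart /Defs.dart /= e_sym.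
  have ps : phi (swap d1) = rho d1 by case: (d1).
  have sr : Rc (swap d1) (rho d1) by rewrite -ps; apply: target_conn; rewrite //= d1u.
  have [td|td] := boolP (tree d1); last first.
    apply: Rc_trans sr; apply: connect1; rewrite /ex l2 //=; apply/andP; split.
      by apply: (@inB _ u) => //; rewrite d1u eqxx.
    by apply: (@inB _ u) => //=; rewrite d1u eqxx ?orbT.
  move: td; rewrite /tree d1u.
  case/orP => /andP[rc /eqP E]; first by rewrite (negPf rc) E eqxx in H.
  have [_ rk] := parP rc; have xc : x \in R d1.2 by apply: R_par; rewrite -E.
  have [pd1 ps1] := phi_dart dd1.
  apply: Rc_trans (target_conn dd1 xc) (Rc_trans _ sr).
  have ltM : M - rank d1.2 < n.
    by rewrite -En ltn_sub2l // E //; apply: leq_trans rk (leM _).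
  exact: (IHn _ ltM d1.2).
have orb p d1 : dart p -> p.1 = u -> fconnect rho p d1 -> dart d1 /\ d1.1 = u.
  move=> dp pu; elim/connect_ind_r: d1 / => // y z _ [dy yu] /eqP<-.
  by have [] := rho_dart dy; rewrite yu.
(* The gap is at the dart to the parent; at a root every step succeeds and any dart will do. *)
have [p [dp pu pP]] : exists p, [/\ dart p, p.1 = u &
    forall d1, d1 != p -> d1.1 = u -> (root e u == u) || (d1.2 != par u)].
  have [ru|ru] := eqVneq (root e u) u; first by exists d.
  have [eu _] := parP ru.
  exists (u, par u); split=> //; first by rewrite /dart /Defs.dart /= e_sym.
  by move=> [a b] /= + E; rewrite -E xpair_eqE eqxx.
apply: (@orbit_gap _ rho Rc p) => //.
- exact: perm_inj.
- by move=> d1 pd1 nd1; have [dd1 d1u] := orb _ _ dp pu pd1; apply: step => //; apply: pP.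
- by case: rhoP => _ _; apply=> //; rewrite pu.
- by case: rhoP => _ _; apply=> //; rewrite pu.
Qed.

Let desc_dart u d : x \in R u -> dart d -> d.1 = u -> exists2 d0, dart d0 & d0.1 = x.
Proof.
move En: (rank u) => n; elim/ltn_ind: n u En d => n IHn u En d xu dd du.
have [->|[ru xp]] := R_inv xu; first by exists d.
have [eu rk] := parP ru.
by apply: (IHn (rank (par u)) _ (par u) erefl (par u, u)) => //; rewrite -En.
Qed.

(** Climb the forest towards [x]: go round [u] to the successor of [(par u, u)] on its face, then
    back to that dart, which starts at the parent. *)
Let desc_conn u d d0 : x \in R u -> dart d -> d.1 = u -> dart d0 -> d0.1 = x -> Rc d d0.
Proof.
move=> + + + dd0 d0x.
move En: (rank u) => n; elim/ltn_ind: n u En d => n IHn u En d xu dd du.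
have [xE|[ru xp]] := R_inv xu; first by apply: (vertex_conn xu) => //; rewrite d0x.
have [eu rk] := parP ru.
have dp : dart (par u, u) by [].
have [pd ps] := phi_dart dp.
apply: (Rc_trans (d2 := phi (par u, u))); first exact: vertex_conn ps.
apply: (Rc_trans (d2 := (par u, u))); first by apply: Rc_sym; apply: target_conn.
by apply: (IHn (rank (par u)) _ (par u)) => //; rewrite -En.
Qed.

Let node_dart d : dart d -> x \in B (Some d) ->
  exists d', [/\ dart d', x \in R d'.1 & Rc d d'].
Proof.
move=> dd; rewrite /= dd !in_setU => /orP[/orP[]|] xd.
- by exists d.
- by have [pd ps] := phi_dart dd; exists (phi d); rewrite ps; split=> //; apply: target_conn.
- exists (base d); split=> //; [exact: base_dart|exact: face_conn].
Qed.

Let isol_node d : ~~ dart d -> x \in B (Some d) -> d = (x, x) /\ isol x.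
Proof.
move=> nd; rewrite /= (negPf nd); case: ifP => [/andP[/eqP E id]|]; last by rewrite inE.
have rd : root e d.1 = d.1.
  apply/eqP; rewrite -/(roots e d.1); apply/negPn/negP => rd.
  have [] := parP rd; rewrite e_sym => ed _; by move/forallP: id => /(_ (par d.1)); rewrite ed.
move=> /(R_root rd) ->; split=> //; by case: d E {nd id rd} => a b /= ->.
Qed.

Lemma embedding_vertex_conn i j : x \in B i -> x \in B j -> connect ex i j.
Proof.
have bad d d1 : dart d -> x \in B (Some d) -> ~~ dart d1 -> x \in B (Some d1) -> False.
  move=> dd xd nd1 /(isol_node nd1)[_ ix]; have [d' [dd' xd' _]] := node_dart dd xd.
  by have [d0 /dart_nisol + E] := desc_dart xd' dd' erefl; rewrite E ix.
case: i => [d|]; last by rewrite inE.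
case: j => [d'|]; last by rewrite inE.
have [dd|nd] := boolP (dart d); have [dd'|nd'] := boolP (dart d').
- move=> xd xd'; have [d1 [dd1 x1 c1]] := node_dart dd xd.
  have [d2 [dd2 x2 c2]] := node_dart dd' xd'.
  have [d0 dd0 E] := desc_dart x1 dd1 erefl.
  apply: Rc_trans c1 (Rc_trans (desc_conn x1 dd1 erefl dd0 E) _).
  by apply: Rc_sym; apply: Rc_trans c2 (desc_conn x2 dd2 erefl dd0 E).
- by move=> xd xd'; case: (bad d d').
- by move=> xd xd'; case: (bad d' d).
- by move=> /(isol_node nd)[-> _] /(isol_node nd')[-> _].
Qed.

End Vertex.

Let root_in_R u : root e u \in R u.
Proof.
move En: (rank u) => n; elim/ltn_ind: n u En => n IHn u En.
have [->|ru] := eqVneq (root e u) u; first exact: R_refl.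
have [eu rk] := parP ru; apply: R_par.
have -> : root e u = root e (par u) by apply/esym/(rootP c_sym)/connect1.
by apply: (IHn (rank (par u))); rewrite -?En.
Qed.

(** Every dart of a component has the component's root in its bag, and the bags with that root are
    connected; hence one link to the hub per component is enough. *)
Let all_conn i j : connect (links l) i j.
Proof.
suff H k : connect (links l) None k.
  by apply: connect_trans (H j); rewrite (sym_connect_sym (@links_sym _ l)).
case: k => [d|]; last exact: connect0.
have [dd|nd] := boolP (dart d); last exact/connect1/l3.
have rr : root e (root e d.1) = root e d.1 by rewrite root_root.
have ir : ~~ isol (root e d.1).
  apply/negP => ir; have E : d.1 = root e d.1.
    have /connectP[[|y p] /= pP E] : connect e (root e d.1) d.1.
      by rewrite c_sym connect_root.
      by [].
    by case/andP: pP => ry _; move/forallP: ir => /(_ y); rewrite ry.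
  by have := dart_nisol dd; rewrite E ir.
apply: connect_trans (connect1 (l4 rr ir)) _.
have xd : root e d.1 \in B (Some d) by rewrite /= dd !in_setU root_in_R.
have xh : root e d.1 \in B (Some (hd (root e d.1))).
  by rewrite /= hd_dart // !in_setU R_refl.
by apply: connect_sub (embedding_vertex_conn xh xd) => a b /and3P[ab _ _]; apply: connect1.
Qed.

(** * Counting links with Euler's formula *)

Hypothesis genusP : rotation_genus e rho g.

(** [phi] sends [S1] to darts that are not roots of their face orbit, and faces are counted by these
    roots. *)
Let count1 : #|S1| + num_faces e rho <= num_darts e.
Proof.
rewrite -(card_imset _ phi_inj) /num_faces /num_darts /n_comp_mem -cardUI.
rewrite [X in _ + X <= _]eq_card0 ?addn0; last first.
  move=> d; rewrite !inE; apply/negP => /andP[/imsetP[d' + ->]].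
  rewrite inE => /andP[dd' nd'].
  case/andP=> [/eqP rd _].
  by move: nd'; rewrite -[X in X != _]rd (base_eq (fconnect1 phi d')) eqxx.
apply/subset_leq_card/subsetP => d; rewrite !inE => /orP[/imsetP[d' + ->]|/andP[]//].
by rewrite inE => /andP[/phi_dart[]].
Qed.

Let nonroots := [set v | root e v != v].

Let card_nonroots : #|nonroots| + num_components e = #|V|.
Proof.
rewrite addnC /num_components /n_comp_mem -(cardsC [set v | root e v == v]); congr (_ + _).
  by apply: eq_card => v; rewrite !inE andbT.
by apply: eq_card => v; rewrite !inE.
Qed.

Let count2 : 2 * #|S2| + 2 * #|nonroots| <= num_darts e.
Proof.
pose T1 := [set (v, par v) | v in nonroots].
pose T2 := [set (par v, v) | v in nonroots].
have cT1 : #|T1| = #|nonroots| by apply: card_imset => u v [].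
have cT2 : #|T2| = #|nonroots| by apply: card_imset => u v [].
have cS : #|swap @: S2| = #|S2| by apply: card_imset => -[a b] [c d] [-> ->].
have d12 : S2 :&: swap @: S2 = set0.
  apply/setP => d; rewrite !inE; apply/negP => /andP[/and3P[_ _ lt] /imsetP[d']].
  by rewrite inE => /and3P[_ _ lt'] E; move: lt lt'; rewrite E /=; lia.
have dT : T1 :&: T2 = set0.
  apply/setP => d; rewrite !inE; apply/negP => /andP[/imsetP[v + ->] /imsetP[u]].
  rewrite !inE => /parP[_ rv] /parP[_ ru] [E1 E2].
  by move: rv ru; rewrite E2 -E1; lia.
have tT d : d \in T1 :|: T2 -> tree d.
  by rewrite inE => /orP[] /imsetP[v]; rewrite !inE => rv ->; rewrite /tree /= rv eqxx ?orbT.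
have tS d : d \in S2 :|: swap @: S2 -> ~~ tree d.
  rewrite !inE => /orP[/and3P[]//|/imsetP[d']]; rewrite !inE => /and3P[_ + _] ->.
  by rewrite /tree /= orbC.
have dST : (S2 :|: swap @: S2) :&: (T1 :|: T2) = set0.
  apply/setP => d; rewrite [in RHS]inE; apply/negP; rewrite inE => /andP[/tS + /tT].
  by move/negP.
have := cardsUI (S2 :|: swap @: S2) (T1 :|: T2); rewrite dST cards0 addn0.
have := cardsUI S2 (swap @: S2); rewrite d12 cards0 addn0.
have := cardsUI T1 T2; rewrite dT cards0 addn0.
rewrite cT1 cT2 cS => -> -> E.
have -> : 2 * #|S2| + 2 * #|nonroots| = #|S2| + #|S2| + (#|nonroots| + #|nonroots|) by lia.
rewrite -E; apply/subset_leq_card/subsetP => d; rewrite !inE -!orbA.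
case/or4P => [/and3P[]//|/imsetP[d']|/imsetP[v]|/imsetP[v]].
- by rewrite inE => /and3P[+ _ _] ->; rewrite /dart /Defs.dart /= e_sym.
- by rewrite inE => /parP[+ _] ->; rewrite /dart /Defs.dart /= e_sym.
- by rewrite inE => /parP[+ _] ->.
Qed.

Let count3 : #|S3| + num_darts e = #|V| * #|V|.
Proof.
rewrite -card_prod -(cardsC [set d | dart d]) addnC; congr (_ + _).
  by apply: eq_card => v; rewrite !inE.
by apply: eq_card => v; rewrite !inE.
Qed.

Let count4 : #|S4| + num_isolated e <= num_components e.
Proof.
rewrite /num_isolated /num_components /n_comp_mem -cardUI.
rewrite [X in _ + X <= _]eq_card0 ?addn0; last first.
  move=> v; rewrite !inE; apply/negP.
  by rewrite /isol; case/andP => /andP[_ /negP].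
apply/subset_leq_card/subsetP => v; rewrite !inE => /orP[/andP[rv _]|iv]; first by apply/andP.
apply/andP; split=> //; apply/negPn/negP => rv.
by have [ev _] := parP rv; move/forallP: iv => /(_ (par v)); rewrite e_sym ev.
Qed.

(** With c components, F faces and I isolated vertices, the four counts add up to at most
    [#|V| * #|V| + |E| + 2c - |V| - F - I]. Euler's formula turns this into [#|V| * #|V| + 2 * g],
    and there are [#|V| * #|V| + 1] nodes. *)
Let count_links : #|l| < #|{: N}| + 2 * g.
Proof.
have lc : #|l| <= #|S1| + #|S2| + #|S3| + #|S4|.
  by do 3![apply: leq_trans (leq_card_setU _ _) (leq_add _ _); rewrite ?leq_imset_card //].
have Nc : #|{: N}| = (#|V| * #|V|).+1 by rewrite card_option card_prod.
move: genusP count1 count2 count3 count4 card_nonroots; rewrite /rotation_genus Nc.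
have ar (x s1 s2 s3 s4 c n v f i vv nr : nat) : x <= s1 + s2 + s3 + s4 ->
  4 * c + n = 2 * (v + f + i) + 4 * g -> s1 + f <= n -> 2 * s2 + 2 * nr <= n ->
  s3 + n = vv -> s4 + i <= c -> nr + c = v -> x < vv.+1 + 2 * g by lia.
exact: ar lc.
Qed.

Lemma embedding_decomposition :
  exists (N : finType) (l : {set N * N}) (B : N -> {set V}),
  [/\ #|l| < #|N| + 2 * g,
      (forall i j, connect (links l) i j) /\
      (forall v i j, v \in B i -> v \in B j ->
          connect (fun x y => [&& links l x y, v \in B x & v \in B y]) i j),
      forall v, exists i, v \in B i,
      forall u v, e u v -> exists i, (u \in B i) && (v \in B i) &
      forall i, exists2 s : seq V, size s <= 3 & B i = \bigcup_(u <- s) ancestors par u].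
Proof.
exists N, l, B; split=> //.
- by split; [exact: all_conn | exact: embedding_vertex_conn].
- move=> v; have [iv|iv] := boolP (isol v).
    exists (Some (v, v)); rewrite /= /dart /Defs.dart /= e_irr eqxx iv; exact: R_refl.
  by exists (Some (hd v)); rewrite /= hd_dart // !in_setU R_refl.
- by move=> u v euv; exists (Some (u, v)); rewrite /= /dart /Defs.dart /= euv !in_setU !R_refl !orbT.
- move=> [d|]; last by exists [::]; rewrite ?big_nil.
  rewrite /B; case: ifP => _.
    by exists [:: d.1; d.2; (base d).1]; rewrite // !big_cons big_nil setU0 setUA.
  case: ifP => _; last by exists [::]; rewrite ?big_nil.
  by exists [:: d.1]; rewrite // big_cons big_nil setU0.
Qed.

End Embedding.

Lemma ancestors_inv (V : finType) (par : V -> V) u x :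
  x \in ancestors par u -> x = u \/ x \in ancestors par (par u).
Proof.
rewrite !inE => /connectP[[|y p] /= pP ->]; first by left.
by case/andP: pP => /eqP<- pP; right; apply/connectP; exists p.
Qed.

(** As [w] bounds the labels that are new at each step, a root path carries at most the label of its
    root plus the cost of the path, hence at most [M] elements. A bag consists of at most three root
    paths, and breaking the [2 * g] surplus links gives the last factor. *)
Lemma bounded_genus_tdec (V : finType) (e : rel V) (g M : nat) (rho : {perm (V * V)})
    (Y : V -> {set V}) (w : V -> V -> nat) :
  symmetric e -> irreflexive e -> rotation_system e rho -> rotation_genus e rho g ->
  (forall y u v, y \in Y u -> y \in Y v ->
     connect (fun a b => [&& e a b, y \in Y a & y \in Y b]) u v) ->
  (forall u v, e u v -> #|Y v :\: Y u| <= w u v) ->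
  (forall v, exists c n, walk e w (root e v) v c n /\ #|Y (root e v)| + c <= M) ->
  tdec (3 * M * (2 * g).+1) (\bigcup_v Y v)
    (fun S => exists u v, (u = v \/ e u v) /\ S = Y u :|: Y v).
Proof.
move=> e_sym e_irr rhoP genusP Yc Yw wM.
have c_sym := sym_connect_sym e_sym.
have [par [cost [rank [par0 parP cost0 costm]]]] :=
  @shortest_path_forest V e w (root e)
    (fun v => etrans (c_sym _ _) (connect_root e v))
    (fun u v uv => rootP c_sym (connect1 uv)).
have [|N [l [B [ln [lc vc] vB eB Bs]]]] :=
  @embedding_decomposition V e g rho e_sym e_irr rhoP par rank par0 _ genusP.
  by move=> v /parP[].
pose P v := \bigcup_(x in ancestors par v) Y x.
have Pc v : #|P v| <= #|Y (root e v)| + cost v.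
  move En: (rank v) => n; elim/ltn_ind: n v En => n IHn v En.
  have [rv|rv] := eqVneq (root e v) v.
    rewrite rv; apply: leq_trans (leq_addr _ _); apply/subset_leq_card/bigcupsP => x.
    case/ancestors_inv => [->//|].
    have -> : ancestors par (par v) = [set v]; last by rewrite inE => /eqP->.
    apply/setP => z; rewrite !inE (par0 _ rv); apply/idP/eqP => [|->]; last exact: connect0.
    by move/iter_findex <-; elim: (findex par v z) => //= k ->; apply: par0.
  have [ev rk ->] := parP v rv.
  have -> : root e v = root e (par v) by apply/esym/(rootP c_sym)/connect1.
  have := IHn _ _ (par v) erefl; rewrite -En => /(_ rk) IH.
  rewrite addnA; apply: leq_trans (leq_add IH (Yw _ _ ev)).
  apply: leq_trans (leq_card_setU _ _); apply/subset_leq_card/bigcupsP => x.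
  have pvP : Y (par v) \subset P (par v).
    by apply: (bigcup_sup (par v)); rewrite inE connect0.
  case/ancestors_inv => [->|xp].
    apply/subsetP => y yv; rewrite in_setU in_setD yv andbT.
    by case: (boolP (y \in Y (par v))) => [/(subsetP pvP)->|]; rewrite ?orbT.
  by apply: subset_trans (subsetUl _ _); apply: bigcup_sup xp.
have PM v : #|P v| <= M.
  have [c [n [vw le]]] := wM v; apply: leq_trans (Pc v) (leq_trans _ le).
  by rewrite leq_add2l; apply: costm vw.
apply: gdec_tdec; exists N, l, (fun i => \bigcup_(u in B i) Y u); split=> //.
- move=> y i j /bigcupP[u ui yu] /bigcupP[v vj yv].
  pose ey i j := [&& links l i j, y \in \bigcup_(u in B i) Y u & y \in \bigcup_(u in B j) Y u].
  have one z i' j' : y \in Y z -> z \in B i' -> z \in B j' -> connect ey i' j'.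
    move=> yz zi zj; apply: connect_sub (vc _ _ _ zi zj) => a b /and3P[ab za zb].
    by apply: connect1; rewrite /ey ab /=; apply/andP; split; apply/bigcupP; exists z.
  have ind z : connect (fun a b => [&& e a b, y \in Y a & y \in Y b]) u z ->
      forall k, z \in B k -> y \in Y z -> connect ey i k.
    elim/connect_ind_r: z / => [k uk _|a b _ IH /and3P[ab ya yb] k bk _].
      exact: one ui uk.
    have [k' /andP[ak' bk']] := eB _ _ ab.
    by apply: connect_trans (IH k' ak' ya) (one _ _ _ yb bk' bk).
  exact: ind (Yc _ _ _ yu yv) _ vj yv.
- move=> S [u [v [uv ->]]].
  have [i /andP[ui vi]] : exists i, (u \in B i) && (v \in B i).
    case: uv => [<-|]; last exact: eB.
    by have [i ui] := vB u; exists i; rewrite ui.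
  by exists i; rewrite subUset; apply/andP; split; [apply: (bigcup_sup u)|apply: (bigcup_sup v)].
- move=> i; apply/andP; split; last by apply/bigcupsP => u _; apply: (bigcup_sup u).
  have [s s3 ->] := Bs i.
  apply: (@leq_trans (size s * M)); last by rewrite leq_mul2r s3 orbT.
  elim: s {s3} => [|a s IH]; first by rewrite big_nil big_set0 cards0.
  rewrite big_cons bigcup_setU mulSn.
  exact: leq_trans (leq_card_setU _ _) (leq_add (PM a) IH).
Qed.

(** * Ladders *)

Section Steps.
Variable V : eqType.
Implicit Types (s : seq V) (a b : V).

Definition steps s := zip s (behead s).

Lemma steps_cat s1 a s2 : steps (s1 ++ a :: s2) = steps (rcons s1 a) ++ steps (a :: s2).
Proof. by elim: s1 => [|b [|c s1] IH] //; congr (_ :: _); apply: IH. Qed.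

Lemma mem_steps s a b : ((a, b) \in steps s) -> (a \in s) && (b \in s).
Proof.
elim: s => [|c [|d s] IH] //; rewrite [steps _]/= !inE => /orP[/eqP[-> ->]|/IH].
  by rewrite !eqxx orbT.
by rewrite !inE => /andP[-> ->]; rewrite !orbT.
Qed.

Lemma steps_uniq s : uniq s -> uniq (steps s).
Proof.
elim: s => [|c [|d s] IH] // /andP[cs us]; rewrite [steps _]/= cons_uniq IH // andbT.
by apply: contra cs => /mem_steps/andP[].
Qed.

Lemma steps_succ s a b c : uniq s -> (a, b) \in steps s -> (a, c) \in steps s -> b = c.
Proof.
elim: s => [|x [|y s] IH] // /andP[xs us]; rewrite [steps _]/= !inE.
have no z : (x, z) \in steps (y :: s) -> False.
  by move=> /mem_steps/andP[xs' _]; rewrite xs' in xs.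
case/orP=> [/eqP[-> ->]|ab] /orP[/eqP[]|ac] //.
- by case: (no _ ac).
- by move=> ax _; rewrite ax in ab; case: (no _ ab).
- exact: IH.
Qed.

Lemma steps_rev s a b : (a, b) \in steps s -> (b, a) \in steps (rev s).
Proof.
elim: s => [|x [|y s] IH] //; rewrite [steps _]/= inE.
rewrite rev_cons [rev (y :: s)]rev_cons -!cats1 -catA /= steps_cat mem_cat.
case/orP=> [/eqP[-> ->]|/IH]; first by rewrite inE eqxx orbT.
by rewrite rev_cons => ->.
Qed.

Lemma sorted_steps (e : rel V) s : sorted e s = all (fun p => e p.1 p.2) (steps s).
Proof. by elim: s => [|x [|y s] IH] //; congr (_ && _); apply: IH. Qed.

(** Successors in a duplicate-free sequence are unique, so a simple path using only its steps has to
    follow it. *)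
Lemma uniq_segment_eq s s1 s2 s3 q u v : uniq s -> s = s1 ++ u :: s2 ++ v :: s3 ->
  uniq (u :: rcons q v) -> {subset steps (u :: rcons q v) <= steps s} -> q = s2.
Proof.
move=> us; elim: q u s1 s2 => [|d q IH] u s1 [|c s2] // Es uq sub.
- have uv : (u, v) \in steps s by apply: sub; rewrite inE.
  have uc : (u, c) \in steps s by rewrite Es steps_cat mem_cat /= inE eqxx !orbT.
  have := us; rewrite Es -(steps_succ us uv uc) -cat_rcons cat_uniq => /and3P[_ _].
  by rewrite /= mem_cat inE eqxx orbT.
- have ud : (u, d) \in steps s by apply: sub; rewrite /steps /= inE eqxx.
  have uv : (u, v) \in steps s by rewrite Es steps_cat mem_cat /= inE eqxx !orbT.
  move: uq; rewrite (steps_succ us ud uv) /= => /and3P[_ + _].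
  by rewrite mem_rcons inE eqxx.
- have ud : (u, d) \in steps s by apply: sub; rewrite /steps /= inE eqxx.
  have uc : (u, c) \in steps s by rewrite Es steps_cat mem_cat /= inE eqxx !orbT.
  have dc := steps_succ us ud uc; rewrite {d ud}dc in uq sub *.
  congr (_ :: _); apply: (IH c (rcons s1 u)); first by rewrite Es cat_rcons.
    by case/andP: uq.
  by move=> p pc; apply: sub; rewrite /steps /= inE; apply/orP; right.
Qed.

End Steps.

Section Ladders.
Variable V : finType.
Implicit Types (p r s : seq V).

Definition is_step (s : seq V) (S : {set V}) := exists2 a, a \in steps s & S = [set a.1; a.2].

(** A fan: every step of the path shares its bag with the last vertex. *)
Lemma tdec_path x p : uniq (x :: p) ->
  tdec 3 [set z in x :: p] (fun S => S = [set x; last x p] \/ is_step (x :: p) S).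
Proof.
elim: p x => [|y p IH] x.
  move=> _; have := @tdec_bag V 3 [set x] [set x]; rewrite cards1 => /(_ isT (subxx _)).
  apply: gdec_weaken => //.
  - by apply/subsetP => z; rewrite !inE.
  - by move=> S [->|[] //]; exists [set x] => //=; rewrite setUid.
move=> /andP[xp up].
have c3 : #|[set x; y; last y p]| <= 3.
  by rewrite -setUA cardsU1 cards2; do 2!case: (_ \notin _ : bool) || case: (_ != _).
have dB := tdec_bag c3 (subxx _).
have := @tdec_glue _ _ _ _ _ _ [set y; last y p] [set y; last y p] (IH y up) dB.
case=> //; [by left|by rewrite -setUA subsetUr| | |].
- apply/subsetP => z; rewrite !inE => /andP[zp /orP[/orP[/eqP zx|->//]|->]]; last by rewrite orbT.
  by rewrite -zx inE zp in xp.
- apply/subsetP => z; rewrite !inE => /andP[zp /orP[/orP[/eqP zx|->//]|->]]; last by rewrite orbT.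
  by rewrite -zx inE zp in xp.
move=> N dec; have : tdec 3 ([set z in y :: p] :|: [set x; y; last y p])
   (fun S => (S = [set y; last y p] \/ is_step (y :: p) S) \/ S \subset [set x; y; last y p]).
  by exists N.
apply: gdec_weaken => //.
  apply/subsetP => z; rewrite !inE => /orP[->|/orP[/orP[->|->]|/eqP->]]; rewrite ?orbT //.
  by have := mem_last y p; rewrite inE => ->; rewrite orbT.
move=> S [->|[a]]; last rewrite [steps _]/= inE.
  exists [set x; y; last y p]; first by right.
  by rewrite /= setSU // subsetUl.
case/orP => [/eqP-> ->|ay ->].
  by exists [set x; y; last y p]; [right|rewrite subsetUl].
by exists [set a.1; a.2] => //; left; right; exists a.
Qed.

(* [p] and [r] are listed from their outer ends to their common last vertex. *)
Definition ladder x p y r := tdec 3 ([set z in x :: p] :|: [set z in y :: r])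
  (fun S => [\/ S = [set x; y], is_step (x :: p) S | is_step (y :: r) S]).

Lemma ladder_sym x p y r : ladder x p y r -> ladder y r x p.
Proof.
apply: gdec_weaken => // [|S]; first by rewrite setUC.
case=> [->|pS|rS]; first by exists [set x; y]; [constructor 1|rewrite setUC].
  by exists S => //; constructor 3.
by exists S => //; constructor 2.
Qed.

Lemma ladder_peel x z p y r :
  x \notin z :: p -> x \notin y :: r -> ladder z p y r -> ladder x (z :: p) y r.
Proof.
move=> xp xr L.
have c3 : #|[set x; z; y]| <= 3.
  by rewrite -setUA cardsU1 cards2; do 2!case: (_ \notin _ : bool) || case: (_ != _).
have dB := tdec_bag c3 (subxx _).
have sub : ([set u in z :: p] :|: [set u in y :: r]) :&: [set x; z; y] \subset [set z; y].
  apply/subsetP => u; rewrite !in_setI !in_setU !in_set => /andP[ur].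
  rewrite !in_set1 => /orP[/orP[/eqP ux|->//]|->]; last by rewrite orbT.
  by move: ur; rewrite ux (negPf xp) (negPf xr).
have := @tdec_glue _ _ _ _ _ _ [set z; y] [set z; y] L dB.
move=> /(_ _ _ sub sub) H; apply: gdec_weaken (H _ _) => //; last 2 first.
- by constructor 1.
- by rewrite -setUA subsetUr.
- apply/subsetP => u; rewrite !in_setU !in_set !in_set1 !inE.
  by case/orP => [/orP[/orP[->|->]|/orP[->|->]]|/orP[/orP[->|->]|->]]; rewrite ?orbT.
move=> S [->|[a]|rS].
- exists [set x; z; y]; first by right.
  by rewrite setSU // subsetUl.
- rewrite [steps _]/= inE => /orP[/eqP-> ->|ap ->].
    by exists [set x; z; y]; [right|rewrite subsetUl].
  by exists [set a.1; a.2] => //; left; constructor 2; exists a.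
- by exists S => //; left; constructor 3.
Qed.

(** Where the sequences visit two vertices in opposite orders, they share the whole segment between
    them; this excludes crossing rungs. *)
Definition reversing (s s' : seq V) := forall s1 u s2 v s3 s1' s2' s3',
  s = s1 ++ u :: s2 ++ v :: s3 -> s' = s1' ++ v :: s2' ++ u :: s3' -> s2' = rev s2.

Lemma reversing_sym s s' : reversing s s' -> reversing s' s.
Proof. by move=> H s1 u s2 v s3 t1 t2 t3 Es Et; rewrite (H _ _ _ _ _ _ _ _ Et Es) revK. Qed.

Lemma reversing_suffix s s' t t' : reversing (t ++ s) (t' ++ s') -> reversing s s'.
Proof.
move=> H s1 u s2 v s3 s1' s2' s3' Es Es'.
by apply: (H (t ++ s1) u s2 v s3 (t' ++ s1') s2' s3'); rewrite ?Es ?Es' catA.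
Qed.

(** An end that is not on the other side is peeled off. If each end lies on the other side, the two
    are visited in opposite orders, so the stretch between them is common; it is decomposed as a
    path and glued to the remaining ladder, whose ends have changed sides. *)
Lemma ladderP x p y r : uniq (x :: p) -> uniq (y :: r) -> last x p = last y r ->
  reversing (x :: p) (y :: r) -> ladder x p y r.
Proof.
move En: (size p + size r) => n; elim/ltn_ind: n x p y r En => n IHn x p y r En up ur lpr rev_pr.
have peel x' p' y' r' : size p' + size r' = n -> uniq (x' :: p') -> uniq (y' :: r') ->
    last x' p' = last y' r' -> reversing (x' :: p') (y' :: r') -> x' \notin y' :: r' ->
    ladder x' p' y' r'.
  case: p' => [|z p'] En' up' ur' l' rev' nx'.
    by rewrite [x'](l' : x' = _) mem_last in nx'.
  apply: ladder_peel => //; first by case/andP: up'.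
  apply: (IHn (size p' + size r')) => //; first by rewrite -En'.
    by case/andP: up'.
  exact: (@reversing_suffix _ _ [:: x'] [::]).
have [xr|xr] := boolP (x \in y :: r); last exact: peel.
have [yp|yp] := boolP (y \in x :: p); last first.
  by apply/ladder_sym/peel => //; [rewrite addnC|apply: reversing_sym].
have [xy|xy] := eqVneq x y.
  subst y; case: p En up lpr rev_pr {yp} => [|z p] En up lpr rev_pr.
    case: r En ur lpr {rev_pr xr} => [|z r] En ur lpr; last first.
      by case/andP: ur; rewrite [last _ _]/= in lpr; rewrite {1}lpr /= mem_last.
    have := @tdec_bag V 3 [set x] [set x]; rewrite cards1 => /(_ isT (subxx _)).
    apply: gdec_weaken => //.
    - by apply/subsetP => u; rewrite !inE => ->.
    - by move=> S [->|[]|[]] //; exists [set x]; rewrite // setUid.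
  have up' : uniq (z :: p) by case/andP: up.
  have := IHn (size p + size r) _ z p x r erefl up' ur lpr.
  rewrite -En => /(_ (leqnn _) (@reversing_suffix _ _ [:: x] [::] rev_pr)).
  apply: gdec_weaken => //.
    by apply/subsetP => u; rewrite !inE => /orP[->|->]; rewrite ?orbT.
  move=> S [->|[a]|rS].
  - by exists [set z; x]; [constructor 1|rewrite setUid subsetUr].
  - rewrite [steps _]/= inE => /orP[/eqP-> ->|ap ->].
      by exists [set z; x]; [constructor 1|rewrite setUC].
    by exists [set a.1; a.2] => //; constructor 2; exists a.
  - by exists S => //; constructor 3.
move: xr yp; rewrite !inE (negPf xy) eq_sym (negPf xy) /= => xr yp.
case/splitPr: yp En up lpr rev_pr => p2 p3 En up lpr rev_pr.
case/splitPr: xr En ur lpr rev_pr => r2 r3 En ur lpr rev_pr.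
have Er : r2 = rev p2 := rev_pr [::] x p2 y p3 [::] r2 r3 erefl erefl.
have up3 : uniq (y :: p3) by move: up; rewrite -cat_cons cat_uniq => /and3P[].
have ur3 : uniq (x :: r3) by move: ur; rewrite -cat_cons cat_uniq => /and3P[].
have up2 : uniq (x :: rcons p2 y).
  by move: up; rewrite -cat_rcons -cat_cons cat_uniq => /andP[].
have L : ladder y p3 x r3.
  apply: (IHn (size p3 + size r3)) => //.
  - by rewrite -En !size_cat /=; lia.
  - by move: lpr; rewrite !last_cat.
  - exact: (@reversing_suffix _ _ (x :: p2) (y :: r2)).
have sub : ([set u in y :: p3] :|: [set u in x :: r3]) :&: [set u in x :: rcons p2 y]
    \subset [set x; y].
  apply/subsetP => u; rewrite !inE mem_rcons inE => /andP[+ /or3P[->//|->|u2]].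
  by move=> _; rewrite orbT.
  have np : u \notin y :: p3.
    move: up; rewrite -cat_cons cat_uniq => /and3P[_ /hasPn H _].
    by apply/negP => /H; rewrite inE u2 orbT.
  have nr : u \notin x :: r3.
    move: ur; rewrite -cat_cons cat_uniq => /and3P[_ /hasPn H _].
    by apply/negP => /H; rewrite inE Er mem_rev u2 orbT.
  move: np nr; rewrite !inE !negb_or => /andP[/negPf-> /negPf->] /andP[/negPf-> /negPf->].
  by [].
have := tdec_glue L (tdec_path up2) (S1 := [set x; y]) (S2 := [set x; y]).
rewrite last_rcons => /(_ _ _ sub sub) H; apply: gdec_weaken (H _ _) => //; last 2 first.
- by constructor 1; rewrite setUC.
- by left.
- apply/subsetP => u; rewrite Er !inE !mem_rcons !mem_cat !inE mem_rev.
  by case: (u == x); case: (u == y); case: (u \in p2); case: (u \in p3); case: (u \in r3).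
move=> S [->|[a]|[a]].
- by exists [set x; y] => //; right; left.
- rewrite -cat_cons steps_cat mem_cat => /orP[ap ->|ap ->].
    by exists [set a.1; a.2] => //; right; right; exists a; rewrite // -rcons_cons.
  by exists [set a.1; a.2] => //; left; constructor 2; exists a.
- rewrite -cat_cons steps_cat mem_cat => /orP[ap ->|ap ->].
    exists [set a.1; a.2] => //; right; right; exists (a.2, a.1); last by rewrite setUC.
    have -> : x :: rcons p2 y = rev (rcons (y :: r2) x).
      by rewrite Er rev_rcons rev_cons revK.
    by apply: steps_rev; case: a ap.
  by exists [set a.1; a.2] => //; left; constructor 3; exists a.
Qed.

End Ladders.

(** * Strongly connected subgraphs *)

Lemma path_steps (V : eqType) (e : rel V) x p :
  path e x p = all (fun a => e a.1 a.2) (steps (x :: p)).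
Proof. exact: (sorted_steps e (x :: p)). Qed.

Lemma steps_path (V : eqType) (x : V) p : path (fun a b => (a, b) \in steps (x :: p)) x p.
Proof. by rewrite path_steps; apply/allP => -[]. Qed.

Lemma path_connect_last (V : finType) (e : rel V) x p z :
  path e x p -> z \in x :: p -> connect e x z /\ connect e z (last x p).
Proof.
move=> pP zp; split; first exact: (path_connect pP).
case/splitPl: zp pP => p1 p2 <-; rewrite cat_path last_cat => /andP[_ pP].
by apply/connectP; exists p2.
Qed.

(* [q] is chosen with fewest arcs outside [x :: p]: a segment running forwards
   between two vertices of [p] could be replaced by the segment of [p]. *)
Lemma reversing_return (V : finType) (e : rel V) (U : {set V}) x p y :
  path e x p -> uniq (x :: p) -> {in p, forall z, z \notin U} ->
  y \in U -> connect e (last x p) y ->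
  exists q, [/\ path e (last x p) q, uniq (last x p :: q), last (last x p) q \in U,
    {in last x p :: q, forall z, z \in U -> z = last (last x p) q} &
    reversing (x :: p) (rev (last x p :: q))].
Proof.
set t := last x p => pP up pU yU ty.
pose good q := [/\ path e t q, uniq (t :: q), last t q \in U &
  {in t :: q, forall z, z \in U -> z = last t q}].
have [q0 g0] : exists q, good q.
  have sub z q : path e z q -> last z q \in U -> exists q', [/\ path e z q', last z q' \in U &
      {in belast z q', forall z, z \notin U}].
    elim: q z => [|z' q IH] z /=; first by move=> _ zU; exists [::]; split.
    case/andP=> zz' qP qU; have [zU|zU] := boolP (z \in U); first by exists [::]; split.
    have [q' [q'P q'U bU]] := IH z' qP qU; exists (z' :: q'); split=> //=; first by rewrite zz'.
    by move=> u; rewrite inE => /orP[/eqP->|/bU].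
  case/connectP: ty => q qP Ey; rewrite Ey in yU.
  have [q' [q'P q'U bU]] := sub _ _ qP yU; move: q'U.
  have allU z : z \in t :: q' -> z \in U -> z = last t q'.
    rewrite lastI mem_rcons inE => /orP[/eqP//|/bU/negPf->//].
  case/shortenP: q'P allU => q2 q2P uq2 subq2 allU lU; exists q2; split=> // z zq.
  apply: allU; move: zq; rewrite !inE => /orP[->//|/subq2->]; by rewrite orbT.
pose mu q := #|[set a | (a \in steps (t :: q)) && (a \notin steps (x :: p))]|.
have [_ [q gq <-] qmin] := @prop_least (fun n => exists2 q, good q & mu q = n)
  (ex_intro _ _ (ex_intro2 _ _ q0 g0 erefl)).
have [qP uq lU allU] := gq; exists q; split=> //.
move=> p1 u p2 v p3 r1 r2 r3 Ep Er.
have Eq : t :: q = rev r3 ++ u :: rev r2 ++ v :: rev r1.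
  by rewrite -[t :: q]revK Er rev_cat !rev_cons rev_cat !rev_cons -!cats1 -!catA /=.
move: (rev r3) (rev r1) Eq => q1 q3 Eq.
suff <- : rev r2 = p2 by rewrite revK.
move: (rev r2) Eq => {r1 r2 r3 Er} q2 Eq.
(* [w] is [q] with the segment of [p] from [u] to [v] in place of its own. It may revisit vertices,
   hence the simple path [w'] extracted from it below. *)
have [w Ew] : exists w, q1 ++ u :: p2 ++ v :: q3 = t :: w.
  case: q1 Eq => [|c q1] [<- _] /=; by [exists (p2 ++ v :: q3)|exists (q1 ++ u :: p2 ++ v :: q3)].
have stw : steps (t :: w) = steps (rcons q1 u) ++ steps (u :: rcons p2 v) ++ steps (v :: q3).
  by rewrite -Ew steps_cat -cat_cons steps_cat rcons_cons.
have stq : steps (t :: q) = steps (rcons q1 u) ++ steps (u :: rcons q2 v) ++ steps (v :: q3).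
  by rewrite Eq steps_cat -cat_cons steps_cat rcons_cons.
have stp : steps (x :: p) = steps (rcons p1 u) ++ steps (u :: rcons p2 v) ++ steps (v :: p3).
  by rewrite Ep steps_cat -cat_cons steps_cat rcons_cons.
have lw : last t w = last t q.
  have -> : last t w = last t (t :: w) by [].
  have -> : last t q = last t (t :: q) by [].
  by rewrite -Ew Eq !last_cat /= !last_cat.
have wP : path e t w.
  rewrite path_steps stw !all_cat; move: qP pP; rewrite !path_steps stq stp !all_cat.
  by case/and3P=> -> _ -> /and3P[_ -> _].
have vU : v \notin U.
  apply: pU; case: p1 Ep {stp} => [|c p1] [_ ->];
  by rewrite !(mem_cat, inE) eqxx ?orbT.
have p2U z : z \in p2 -> z \notin U.
  move=> zp2; apply: pU; case: p1 Ep {stp} => [|c p1] [_ ->];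
  by rewrite !(mem_cat, inE) zp2 ?orbT.
have allw z : z \in t :: w -> z \in U -> z = last t q.
  rewrite -Ew => zw; have [zp2 zU|zp2] := boolP (z \in p2).
    by have := p2U _ zp2; rewrite zU.
  apply: allU; move: zw; rewrite Eq !mem_cat !inE !mem_cat (negPf zp2) /=.
  by case/or3P => ->; rewrite ?orbT.
move: (steps_path t w) lw allw.
case/shortenP => w' w'P uw' sub lw allw.
have stsub a : a \in steps (t :: w') -> a \in steps (t :: w).
  by move: w'P; rewrite path_steps => /allP H /H; case: a.
have gw : good w'.
  split=> //; rewrite ?lw //.
    rewrite path_steps; apply/allP => a /stsub; move: wP; rewrite path_steps => /allP; exact.
  move=> z zw; apply: allw; move: zw; rewrite !inE => /orP[->//|/sub->]; by rewrite orbT.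
have := qmin _ (ex_intro2 _ _ w' gw erefl) => le_mu.
have ust : uniq (steps (t :: q)) by apply: steps_uniq.
have sub_mu : [set a | (a \in steps (t :: w')) && (a \notin steps (x :: p))] \subset
    [set a | (a \in steps (t :: q)) && (a \notin steps (x :: p))].
  apply/subsetP => a; rewrite !inE => /andP[/stsub + na]; rewrite na andbT.
  rewrite stw stq !mem_cat => /or3P[->//|a2|->]; last by rewrite !orbT.
  by rewrite stp !mem_cat a2 orbT in na.
(* By minimality [w'] keeps all steps of [q] outside [p]. A step of the replaced segment occurs
   nowhere else in [q], so it must be a step of [p]. *)
have eq_mu := elimT eqP (etrans (eqEcard _ _) (introT andP (conj sub_mu le_mu))).
apply: (@uniq_segment_eq _ (x :: p) p1 p2 p3 q2 u v) => //.
  move: uq; rewrite Eq cat_uniq => /and3P[_ _].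
  by rewrite -cat_cons -cat_rcons cat_uniq rcons_cons => /and3P[].
move=> a aq; apply/negPn/negP => na.
have : a \in [set a | (a \in steps (t :: q)) && (a \notin steps (x :: p))].
  by rewrite inE na andbT stq !mem_cat aq orbT.
rewrite -eq_mu inE => /andP[/stsub + _]; rewrite stw !mem_cat.
move: ust; rewrite stq cat_uniq => /and3P[_ /hasPn d1 +]; rewrite cat_uniq => /and3P[_ /hasPn d2 _].
case/or3P => [a1|a2|a3].
- by have := d1 a; rewrite mem_cat aq a1 => /(_ isT).
- by move: na; rewrite stp !mem_cat a2 orbT.
- by have := d2 a a3; rewrite aq.
Qed.

Lemma path_from_set (V : finType) (e : rel V) (U : {set V}) r t :
  r \in U -> t \notin U -> connect e r t ->
  exists x p, [/\ x \in U, path e x p, last x p = t, uniq (x :: p) & {in p, forall z, z \notin U}].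
Proof.
move=> rU + rt; elim/connect_ind_r: t / rt => [|y z _ IH yz zU]; first by rewrite rU.
have [yU|yU] := boolP (y \in U).
  exists y, [:: z]; split=> //=; first by rewrite yz.
    by rewrite inE andbT; apply: contraNneq zU => <-.
  by move=> u; rewrite inE => /eqP->.
have [x [p [xU pP Ep up pU]]] := IH yU.
have [zp|zp] := boolP (z \in x :: p).
  case/splitPl: zp pP up pU {Ep} => p1 p2 Ez; rewrite cat_path => /andP[p1P _] up pU.
  exists x, p1; split=> //; first by move: up; rewrite -cat_cons cat_uniq => /andP[].
  by move=> u up1; apply: pU; rewrite mem_cat up1.
exists x, (rcons p z); split=> //.
- by rewrite rcons_path pP Ep.
- by rewrite last_rcons.
- by rewrite -rcons_cons rcons_uniq zp.
- by move=> u; rewrite mem_rcons inE => /orP[/eqP->|/pU].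
Qed.

Definition is_arc (V : finType) (A : {set V * V}) (S : {set V}) :=
  exists2 a, a \in A & S = [set a.1; a.2].

Section StronglyConnected.
Variables (V : finType) (e : rel V) (K : {set V}).
Hypothesis Kc : forall x y, x \in K -> y \in K -> connect e x y.
Hypothesis Ke : forall x y, e x y -> (x \in K) && (y \in K).

Let spanned (T U : {set V}) (S : {set V * V}) :=
  [/\ U \subset K, T \subset U, {in U &, forall x y, connect (arc_rel S) x y},
      forall a, a \in S -> [&& e a.1 a.2, a.1 \in U & a.2 \in U] &
      tdec (3 * #|T|).+1 U (fun X => X = T \/ is_arc S X)].

(** For [t] outside a nonempty [U], the path to [t] and the path back meet [U] only in their ends
    [x] and [y]. The old bags gain [x], [y], [t] and the ladder bags gain [t], so both sides have a
    bag containing their intersection. *)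
Let spanned_step (T U : {set V}) (S : {set V * V}) t :
  t \in K -> t \notin T -> spanned T U S -> exists U' S', spanned (t |: T) U' S'.
Proof.
move=> tK tT [UK TU Uc SU dec].
have cT : #|t |: T| = #|T|.+1 by rewrite cardsU1 tT.
have [tU|tU] := boolP (t \in U).
  exists U, S; split=> //; first by rewrite subUset sub1set tU.
  apply: gdec_weaken (gdec_add [set t] dec); rewrite ?cards1 ?cT.
  - by lia.
  - by rewrite subUset subxx sub1set.
  move=> X [->|XS]; first by exists (t |: T) => //; exists T; [left|rewrite setUC].
  by exists X => //; exists X; [right|apply: subsetUl].
have [U0|[r rU]] := set_0Vmem U.
  exists [set t], set0; split.
  - by rewrite sub1set.
  - by have := TU; rewrite U0 subset0 => /eqP->; rewrite setU0.
  - by move=> x y; rewrite !inE => /eqP-> /eqP->; apply: connect0.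
  - by move=> a; rewrite in_set0.
  - have T0 : T = set0 by apply/eqP; rewrite -subset0 -U0.
    have := @tdec_bag V (3 * #|t |: T|).+1 [set t] [set t].
    rewrite cards1 => /(_ isT (subxx _)); apply: gdec_weaken => // X [->|[a]].
      by exists [set t]; rewrite // T0 setU0.
    by rewrite in_set0.
have rK : r \in K by apply: (subsetP UK).
have [x [p [xU pP Ep up pU]]] := path_from_set rU tU (Kc rK tK).
have [q [qP uq]] := reversing_return pP up pU rU (etrans (congr1 (connect e ^~ r) Ep) (Kc tK rK)).
rewrite Ep in qP uq *; set y := last t q => yU qU rev_pq.
have Er : rev (t :: q) = y :: rev (belast t q) by rewrite lastI rev_rcons.
set rq := rev (belast t q) in Er.
have lr : last y rq = t.
  have -> : last y rq = last t (y :: rq) by [].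
  by rewrite -Er rev_cons last_rcons.
have L : ladder x p y rq.
  apply: ladderP => //; first by rewrite -Er rev_uniq.
    by rewrite Ep lr.
  by rewrite -Er.
have memq z : (z \in y :: rq) = (z \in t :: q) by rewrite -Er mem_rev.
pose U' := U :|: [set z in x :: p] :|: [set z in t :: q].
pose S' := S :|: [set a in steps (x :: p)] :|: [set a in steps (t :: q)].
have stK (s : seq V) z : path e z s -> z \in K -> {subset z :: s <= K}.
  elim: s z => [|v s IH] z /= => [_ zK u|/andP[zv vs] zK u]; first by rewrite inE => /eqP->.
  by rewrite inE => /orP[/eqP->//|]; apply: IH => //; case/andP: (Ke zv).
have xK : x \in K by apply: (subsetP UK).
have pK := stK _ _ pP xK; have qK := stK _ _ qP tK.
have subU : U \subset U' by rewrite /U' -setUA subsetUl.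
have subS : subrel (arc_rel S) (connect (arc_rel S')).
  by move=> u v uv; apply: connect1; rewrite /arc_rel !inE [(u, v) \in S]uv.
have pS : path (arc_rel S') x p.
  rewrite path_steps; apply/allP => -[u v] uv; rewrite /arc_rel !in_setU !in_set /=.
  by rewrite uv orbT.
have qS : path (arc_rel S') t q.
  rewrite path_steps; apply/allP => -[u v] uv; rewrite /arc_rel !in_setU !in_set /=.
  by rewrite uv !orbT.
have U'c z : z \in U' -> connect (arc_rel S') r z /\ connect (arc_rel S') z r.
  have cU u v : u \in U -> v \in U -> connect (arc_rel S') u v.
    by move=> uU vU; apply: connect_sub subS _ _ (Uc _ _ uU vU).
  have [_ xt] := path_connect_last pS (mem_last x p); rewrite Ep in xt.
  have xt' : connect (arc_rel S') x t by rewrite -Ep; case: (path_connect_last pS (mem_head x p)).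
  have ty : connect (arc_rel S') t y by case: (path_connect_last qS (mem_head t q)).
  rewrite !in_setU !in_set => /orP[/orP[zU|zp]|zq].
  - by split; apply: cU.
  - have [xz zt] := path_connect_last pS zp; rewrite Ep in zt; split.
      exact: connect_trans (cU _ _ rU xU) xz.
    exact: connect_trans zt (connect_trans ty (cU _ _ yU rU)).
  - have [tz zy] := path_connect_last qS zq; split.
      exact: connect_trans (cU _ _ rU xU) (connect_trans xt' tz).
    exact: connect_trans zy (cU _ _ yU rU).
have tU' : t \in U' by rewrite !in_setU !in_set mem_head !orbT.
exists U', S'; split.
- rewrite !subUset UK /=; apply/andP; split; apply/subsetP => z; rewrite inE; first exact: pK.
  exact: qK.
- by rewrite subUset sub1set tU' (subset_trans TU subU).
- move=> u v /U'c[_ ur] /U'c[rv _]; exact: connect_trans ur rv.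
- move=> [u v]; rewrite !in_setU !in_set => /orP[/orP[/SU|uv]|uv] /=.
  + by case/and3P => -> -> ->.
  + have := pP; rewrite path_steps => /allP/(_ _ uv) /= ->.
    by have := mem_steps uv; rewrite !inE => /andP[-> ->]; rewrite !orbT.
  + have := qP; rewrite path_steps => /allP/(_ _ uv) /= ->.
    by have := mem_steps uv; rewrite !inE => /andP[-> ->]; rewrite !orbT.
have c3 : #|[set x; y; t]| <= 3.
  by rewrite -setUA cardsU1 cards2; do 2!case: (_ \notin _ : bool) || case: (_ != _).
have D1 := gdec_add [set x; y; t] dec.
have D2 := gdec_add [set t] L.
have {}D1 := @gdec_weaken _ _ _ (3 * #|t |: T|).+1 _ _ _ _ _ (subxx _) (fun S FS => ex_intro2 _ _ S FS (subxx _)) D1.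
have {}D2 := @gdec_weaken _ _ _ (3 * #|t |: T|).+1 _ _ _ _ _ (subxx _) (fun S FS => ex_intro2 _ _ S FS (subxx _)) D2.
have k1 c : c <= 3 -> (3 * #|T|).+1 + c <= (3 * #|t |: T|).+1.
  rewrite cT; have ar n : c <= 3 -> (3 * n).+1 + c <= (3 * n.+1).+1 by clear; lia.
  exact: ar.
have k2 : 3 + #|[set t]| <= (3 * #|t |: T|).+1.
  rewrite cards1 cT; have ar n : 3 + 1 <= (3 * n.+1).+1 by clear; lia.
  exact: ar.
have sub : (U :|: [set x; y; t]) :&: ([set z in x :: p] :|: [set z in y :: rq] :|: [set t])
    \subset [set x; y; t].
  apply/subsetP => z; rewrite in_setI => /andP[]; rewrite in_setU => /orP[zU|//].
  rewrite !in_setU !in_set memq => /orP[/orP[|zq]|->]; last by rewrite orbT.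
    by rewrite inE => /orP[->//|/pU]; rewrite zU.
  by have := qU z zq zU; rewrite -/y => ->; rewrite !in_set1 eqxx orbT.
have := tdec_glue (D1 (k1 _ c3)) (D2 k2) (S1 := [set x; y; t]) (S2 := [set x; y; t]).
move=> /(_ _ _ sub sub) H; apply: gdec_weaken (H _ _) => //; last 2 first.
- by exists T; [left|rewrite subsetUr].
- by exists [set x; y]; [constructor 1|].
- rewrite !subUset (subset_trans (subxx _) subU) !sub1set tU' !andbT /=.
  have xU' : x \in U' by apply: (subsetP subU).
  have yU' : y \in U' by apply: (subsetP subU).
  rewrite xU' yU' /=; apply/andP; split; apply/subsetP => z.
    by rewrite inE => zp; rewrite !in_setU !in_set zp !orbT.
  by rewrite inE memq => zp; rewrite !in_setU !in_set zp !orbT.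
move=> X [->|[[u v] + ->]].
  exists (t |: T) => //; left; exists T; first by left.
  by rewrite setUC setUS // subsetUr.
rewrite !in_setU !in_set => /orP[/orP[uv|uv]|uv].
- exists [set u; v] => //; left; exists [set u; v]; last exact: subsetUl.
  by right; exists (u, v).
- exists [set u; v] => //; right; exists [set u; v]; last exact: subsetUl.
  by constructor 2; exists (u, v).
- exists [set u; v] => //; right; exists [set u; v]; last exact: subsetUl.
  by constructor 3; exists (v, u); [rewrite -Er; apply: steps_rev|rewrite setUC].
Qed.

Lemma strongly_connected_tdec (T : {set V}) : T \subset K ->
  exists S : {set V * V}, [/\ forall a, a \in S -> e a.1 a.2,
    {in T &, forall x y, connect (arc_rel S) x y} &
    tdec (3 * #|T|).+1 K (fun X => X = T \/ is_arc S X)].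
Proof.
move=> TK; suff [U [S [UK TU Uc SU dec]]] : exists U S, spanned T U S.
  exists S; split=> [a /SU/and3P[]|x y xT yT|] //.
    by apply: Uc; apply: (subsetP TU).
  by apply: gdec_weaken dec => // X; exists X.
have sK : {subset enum T <= K} by move=> t; rewrite mem_enum; apply: (subsetP TK).
have ET : [set z in enum T] = T by apply/setP => z; rewrite inE mem_enum.
suff H s : uniq s -> {subset s <= K} -> exists U S, spanned [set z in s] U S.
  by have := H _ (enum_uniq T) sK; rewrite ET.
elim: s => [_ _|t s IH /= /andP[ts us] {}sK].
  exists set0, set0; split; rewrite ?sub0set //.
  - by move=> x y; rewrite inE.
  - by move=> a; rewrite in_set0.
  have := @tdec_bag V 1 set0 set0; rewrite cards0 => /(_ isT (subxx _)).
  apply: gdec_weaken => // X [->|[a]]; last by rewrite in_set0.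
  by exists set0 => //; apply/subsetP => z; rewrite !inE.
have [|U [S sp]] := IH us.
  move=> z zs; apply: sK.
  by rewrite inE zs orbT.
have [||U' [S' sp']] := @spanned_step [set z in s] U S t _ _ sp.
- by apply: sK; rewrite mem_head.
- by rewrite inE.
exists U', S'; suff -> : [set z in t :: s] = t |: [set z in s] by [].
by apply/setP => z; rewrite !inE.
Qed.
End StronglyConnected.

(** * Reachability-preserving digraphs *)

Section Digraphs.
Variable V : finType.
Implicit Types (A : {set V * V}) (T : {set V}).

Definition reach A := connect (arc_rel A).
Definition sources A T v := [set s in T | reach A s v].
Definition targets A T v := [set t in T | reach A v t].

Definition essential A T := forall f, f \in A -> exists s t,
  [/\ s \in T, t \in T, reach A s t & ~~ reach (A :\ f) s t].

Definition same_sig A T u v :=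
  (sources A T u == sources A T v) && (targets A T u == targets A T v).
Definition cls_link A T u v := (((u, v) \in A) || ((v, u) \in A)) && same_sig A T u v.
Definition cls A T := connect (cls_link A T).
(** An arc whose ends have equal signatures stays within a class, so a change of signature is the
    same as crossing between classes. *)
Definition heads A T v :=
  [set y | cls A T v y && [exists x, ((x, y) \in A) && ~~ same_sig A T x y]].
Definition tails A T v :=
  [set y | cls A T v y && [exists x, ((y, x) \in A) && ~~ same_sig A T y x]].
(** The arcs inside a class that lie on no directed cycle; for minimal arc sets a class having one
    is a directed path. *)
Definition thin A T u v := [&& (u, v) \in A, same_sig A T u v & ~~ reach A v u].

Lemma reach_arc A x y : (x, y) \in A -> reach A x y.
Proof. exact: connect1. Qed.

Lemma reach0 A x : reach A x x.
Proof. exact: connect0. Qed.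

Lemma reach_trans A y x z : reach A x y -> reach A y z -> reach A x z.
Proof. exact: connect_trans. Qed.

Lemma reach_sub A f x y : reach (A :\ f) x y -> reach A x y.
Proof. by apply: connect_sub => u v; rewrite /arc_rel !inE => /andP[_]; apply: connect1. Qed.

(** A walk using the arc is cut before the first use and after the last one. *)
Lemma remove_arc A x y s t : reach A s t ->
  reach (A :\ (x, y)) s t \/ reach (A :\ (x, y)) s x /\ reach (A :\ (x, y)) y t.
Proof.
elim/connect_ind_r: t / => [|u v _ IH uv]; first by left; apply: connect0.
have [E|ne] := eqVneq (u, v) (x, y).
  case: E IH => -> -> [su|[sx _]]; right; split=> //; exact: connect0.
have uv' : reach (A :\ (x, y)) u v.
  by apply: reach_arc; rewrite !inE ne.
case: IH => [su|[sx yu]]; [left|right; split=> //]; exact: connect_trans uv'.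
Qed.

Lemma reach_avoid_tail A x y u v :
  reach A u v -> ~~ reach A u x -> reach (A :\ (x, y)) u v.
Proof.
by move=> /(remove_arc x y)[//|[/reach_sub ux _]]; rewrite ux.
Qed.

Lemma reach_avoid_head A x y u v :
  reach A u v -> ~~ reach A y v -> reach (A :\ (x, y)) u v.
Proof.
by move=> /(remove_arc x y)[//|[_ /reach_sub yv]]; rewrite yv.
Qed.

Lemma reach_last A x y : reach A x y -> x != y -> exists2 z, reach A x z & (z, y) \in A.
Proof. exact: connect_last. Qed.

Section Essential.
Variables (A : {set V * V}) (T : {set V}).
Hypothesis ess : essential A T.

Lemma essential_label x y : (x, y) \in A -> exists s t,
  [/\ [/\ s \in T, t \in T, reach A s y & reach A x t],
      reach (A :\ (x, y)) s x, reach (A :\ (x, y)) y t,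
      ~~ reach (A :\ (x, y)) s y & ~~ reach (A :\ (x, y)) x t].
Proof.
move=> xy; have [s [t [sT tT st nst]]] := ess xy; exists s, t.
have [st'|[sx yt]] := remove_arc x y st; first by rewrite st' in nst.
split=> //.
- split=> //; first exact: connect_trans (reach_sub sx) (reach_arc xy).
  exact: connect_trans (reach_arc xy) (reach_sub yt).
- by apply: contra nst => sy; apply: connect_trans sy yt.
- by apply: contra nst => xt; apply: connect_trans sx xt.
Qed.

(* If two of the entering arcs had the same source as label, one of them could be
   bypassed through the other; likewise if the label of one reached [u]. *)
Lemma card_heads (D : {set V}) v :
  (forall y, y \in D ->
     [/\ reach A v y, reach A y v & exists2 x, (x, y) \in A & ~~ reach A y x]) ->
  #|D| <= #|sources A T v| /\
  forall u, (u, v) \in A -> ~~ reach A v u ->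
    #|D| <= #|sources A T v :\: sources A T u|.+1.
Proof.
move=> DP.
have /fin_all_exists[lab labP] y : exists s, y \in D -> exists x,
    [/\ (x, y) \in A, ~~ reach A y x, s \in T, reach A s x & ~~ reach (A :\ (x, y)) s y].
  have [yD|_] := boolP (y \in D); last by exists y.
  have [_ _ [x xy nyx]] := DP y yD.
  have [s [t [[sT _ _ _] sx _ nsy _]]] := essential_label xy.
  by exists s => _; exists x; split=> //; apply: reach_sub sx.
have labI : {in D &, injective lab}.
  move=> y y' yD y'D E; have [x [xy nyx sT sx nsy]] := labP y yD.
  have [x' [x'y' nyx' _ _ nsy']] := labP y' y'D.
  have [vy yv _] := DP y yD; have [vy' y'v _] := DP y' y'D.
  have yy' := reach_trans yv vy'; have y'y := reach_trans y'v vy.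
  apply/eqP/negPn/negP => ne; case/negP: nsy'; rewrite -E.
  have sx' : reach (A :\ (x', y')) (lab y) x.
    by apply: (reach_avoid_head _ sx); apply: contra nyx => y'x; apply: reach_trans yy' y'x.
  have xy' : reach (A :\ (x', y')) x y.
    by apply: reach_arc; rewrite !inE xy andbT xpair_eqE (negPf ne) andbF.
  apply: reach_trans sx' (reach_trans xy' _); apply: (reach_avoid_tail _ yy').
  by apply: contra nyx' => yx'; apply: reach_trans y'y yx'.
have labS y : y \in D -> lab y \in sources A T v.
  move=> yD; have [x [xy nyx sT sx nsy]] := labP y yD; have [_ yv _] := DP y yD.
  by rewrite inE sT; apply: reach_trans sx (reach_trans (reach_arc xy) yv).
split.
  by rewrite -(card_in_imset labI); apply/subset_leq_card/subsetP => _ /imsetP[y /labS ? ->].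
(* [v] is set aside, since its label may belong to the arc [(u, v)] and reach [u]; this is the extra
   1. *)
move=> u uv nvu; rewrite (cardsD1 v D) -add1n leq_add ?leq_b1 //.
have labI' : {in D :\ v &, injective lab}.
  by move=> y y'; rewrite !inE => /andP[_ yD] /andP[_ y'D]; apply: labI.
rewrite -(card_in_imset labI'); apply/subset_leq_card/subsetP => _ /imsetP[y + ->].
rewrite !inE => /andP[yv yD]; have := labS y yD; rewrite inE => /andP[sT sv].
rewrite sT sv !andbT /=; apply/negP => su.
have [x [xy nyx _ sx nsy]] := labP y yD; have [vy yv' _] := DP y yD.
case/negP: nsy; have su' : reach (A :\ (x, y)) (lab y) u.
  by apply: (reach_avoid_head _ su); apply: contra nvu => yu; apply: reach_trans vy yu.
have uv' : reach (A :\ (x, y)) u v.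
  by apply: reach_arc; rewrite !inE uv andbT xpair_eqE [v == y]eq_sym (negPf yv) andbF.
apply: reach_trans su' (reach_trans uv' _); apply: (reach_avoid_tail _ vy).
by apply: contra nyx => vx; apply: reach_trans yv' vx.
Qed.

(** The target labelling a second arc [(u, w)] is also reached from [v], by a path that cannot
    return to [u]; so [(u, w)] could be bypassed through [v]. *)
Lemma out_arc_unique u v w : (u, v) \in A -> ~~ reach A v u ->
  targets A T u \subset targets A T v -> (u, w) \in A -> w = v.
Proof.
move=> uv nvu sub uw; apply/eqP/negPn/negP => ne.
have [s [t [[_ tT _ ut] _ _ _]]] := essential_label uw; case/negP.
have : t \in targets A T v by apply: (subsetP sub); rewrite inE tT.
rewrite inE tT => vt.
have uv' : reach (A :\ (u, w)) u v; last exact: reach_trans uv' (reach_avoid_tail _ vt nvu).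
by apply: reach_arc; rewrite !inE uv andbT xpair_eqE eqxx eq_sym (negPf ne).
Qed.

End Essential.

(** Reversal exchanges sources with targets and heads with tails, so facts about entering arcs give
    those about leaving arcs. *)
Definition rev_arcs A := [set (f.2, f.1) | f in A].

Lemma mem_rev_arcs A x y : ((x, y) \in rev_arcs A) = ((y, x) \in A).
Proof.
apply/imsetP/idP => [[[a b] ab [-> ->]] //|yx]; by exists (y, x).
Qed.

Lemma reach_rev A x y : reach (rev_arcs A) x y = reach A y x.
Proof.
have H B u v : reach B u v -> reach (rev_arcs B) v u.
  elim/connect_ind_r: v / => [|v w _ IH vw]; first exact: connect0.
  by apply: reach_trans IH; apply: reach_arc; rewrite mem_rev_arcs.
apply/idP/idP => /H //; suff -> : rev_arcs (rev_arcs A) = A by [].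
by apply/setP => -[a b]; rewrite !mem_rev_arcs.
Qed.

Lemma sources_rev A T v : sources (rev_arcs A) T v = targets A T v.
Proof. by apply/setP => z; rewrite !inE reach_rev. Qed.

Lemma targets_rev A T v : targets (rev_arcs A) T v = sources A T v.
Proof. by apply/setP => z; rewrite !inE reach_rev. Qed.

Lemma same_sig_rev A T u v : same_sig (rev_arcs A) T u v = same_sig A T u v.
Proof. by rewrite /same_sig !sources_rev !targets_rev andbC. Qed.

Lemma same_sigC A T u v : same_sig A T u v = same_sig A T v u.
Proof. by rewrite /same_sig eq_sym [targets _ _ u == _]eq_sym. Qed.

Lemma cls_rev A T : cls (rev_arcs A) T =2 cls A T.
Proof.
by apply: eq_connect => u v; rewrite /cls_link same_sig_rev !mem_rev_arcs orbC.
Qed.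

Lemma heads_rev A T v : heads (rev_arcs A) T v = tails A T v.
Proof.
apply/setP => z; rewrite !inE cls_rev; congr (_ && _); apply: eq_existsb => x.
by rewrite mem_rev_arcs same_sig_rev same_sigC.
Qed.

Lemma thin_rev A T u v : thin (rev_arcs A) T u v = thin A T v u.
Proof. by rewrite /thin mem_rev_arcs same_sig_rev same_sigC reach_rev. Qed.

Lemma essential_rev A T : essential A T -> essential (rev_arcs A) T.
Proof.
move=> ess [x y]; rewrite mem_rev_arcs => /ess[s [t [sT tT st nst]]].
exists t, s; split; rewrite ?reach_rev //.
suff -> : rev_arcs A :\ (x, y) = rev_arcs (A :\ (y, x)) by rewrite reach_rev.
apply/setP => -[a b]; rewrite mem_rev_arcs !inE mem_rev_arcs !xpair_eqE.
by rewrite [(a == x) && _]andbC.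
Qed.

Section Classes.
Variables (A : {set V * V}) (T : {set V}).
Hypothesis ess : essential A T.

Lemma in_arc_unique u v w : (u, v) \in A -> ~~ reach A v u ->
  sources A T v \subset sources A T u -> (w, v) \in A -> w = u.
Proof.
move=> uv nvu sub wv.
apply: (out_arc_unique (essential_rev ess) (u := v)); rewrite ?mem_rev_arcs ?reach_rev //.
by rewrite !targets_rev.
Qed.

Lemma sources_sub u v : reach A u v -> sources A T u \subset sources A T v.
Proof.
by move=> uv; apply/subsetP => s; rewrite !inE => /andP[-> su]; apply: reach_trans su uv.
Qed.

Lemma targets_sub u v : reach A u v -> targets A T v \subset targets A T u.
Proof.
by move=> uv; apply/subsetP => s; rewrite !inE => /andP[-> vs]; apply: reach_trans uv vs.
Qed.

Lemma same_sig_reach u v : reach A u v -> reach A v u -> same_sig A T u v.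
Proof.
by move=> uv vu; rewrite /same_sig !eqEsubset !sources_sub // !targets_sub.
Qed.

Lemma cls_sym : symmetric (cls A T).
Proof.
apply: sym_connect_sym => u v.
by rewrite /cls_link orbC same_sigC.
Qed.

Lemma cls_same u v : cls A T u v -> same_sig A T u v.
Proof.
elim/connect_ind_r: v / => [|v w _ + /andP[_]]; first by rewrite /same_sig !eqxx.
by rewrite /same_sig => /andP[/eqP-> /eqP->].
Qed.

Lemma arc_cls u v : (u, v) \in A -> cls A T u v = same_sig A T u v.
Proof.
move=> uv; apply/idP/idP; first exact: cls_same.
by move=> s; apply: connect1; rewrite /cls_link uv.
Qed.

Lemma cls_refl v : cls A T v v.
Proof. exact: connect0. Qed.

Lemma cls_trans : transitive (cls A T).
Proof. exact: connect_trans. Qed.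

Lemma cls_sources u v : cls A T u v -> sources A T u = sources A T v.
Proof. by move=> /cls_same/andP[/eqP]. Qed.

Lemma cls_targets u v : cls A T u v -> targets A T u = targets A T v.
Proof. by move=> /cls_same/andP[_ /eqP]. Qed.

Lemma thin_in u v w : thin A T u v -> (w, v) \in A -> w = u.
Proof.
by case/and3P => uv /andP[/eqP E _] nvu; apply: in_arc_unique => //; rewrite E.
Qed.

Lemma thin_out u v w : thin A T u v -> (u, w) \in A -> w = v.
Proof.
by case/and3P => uv /andP[_ /eqP E] nvu; apply: (out_arc_unique ess) => //; rewrite E.
Qed.

(** A terminal is a source and a target of itself; with equal signatures, a terminal at either end
    would make [v] reach [u]. *)
Lemma thin_notin u v : thin A T u v -> (u \notin T) && (v \notin T).
Proof.
case/and3P => uv /andP[/eqP E1 /eqP E2] nvu; apply/andP; split; apply: contra nvu => wT.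
  have : u \in targets A T u by rewrite inE wT reach0.
  by rewrite E2 inE => /andP[].
have : v \in sources A T v by rewrite inE wT reach0.
by rewrite -E1 inE => /andP[].
Qed.

(** The only link that is hard to follow is a thin arc [(w, z)] taken backwards. It is the only arc
    into [z], so a path from [y] to [z] has already passed through [w]; the hypothesis on [y]
    excludes [z = y]. *)
Lemma cls_reach y z : (forall x, ~~ thin A T x y) -> cls A T y z -> reach A y z.
Proof.
move=> nthin; elim/connect_ind_r: z / => [|z w _ yz]; first exact: connect0.
case/andP => [/orP[zw|wz] s]; first exact: reach_trans yz (reach_arc zw).
have [zw|nzw] := boolP (reach A z w); first exact: reach_trans yz zw.
have tw : thin A T w z by rewrite /thin wz same_sigC s.
have [E|ne] := eqVneq y z; first by have := nthin w; rewrite E tw.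
by have [x yx xz] := reach_last yz ne; rewrite -(thin_in tw xz).
Qed.

Lemma head_nthin v y : y \in heads A T v -> forall x, ~~ thin A T x y.
Proof.
rewrite inE => /andP[_ /existsP[x /andP[xy ns]]] z; apply/negP => tz.
by case/and3P: (tz) => _ + _; rewrite -(thin_in tz xy) (negPf ns).
Qed.

Definition terminals v := [set z | cls A T v z && (z \in T)].

Lemma terminals_sub v : terminals v \subset sources A T v.
Proof.
apply/subsetP => z; rewrite inE => /andP[vz zT].
by rewrite (cls_sources vz) inE zT reach0.
Qed.

(** No thin arc ends in a vertex of [heads], as it would be the only arc there. So each such vertex
    reaches the whole class, and they are mutually reachable as [card_heads] requires. *)
Lemma heads_mutual v y : y \in heads A T v -> forall z, z \in heads A T v ->
  [/\ reach A y z, reach A z y & exists2 x, (x, z) \in A & ~~ reach A z x].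
Proof.
move=> yD z zD; have [vy vz] : cls A T v y /\ cls A T v z.
  by move: yD zD; rewrite !inE => /andP[-> _] /andP[-> _].
have yz : cls A T y z by apply: cls_trans vz; rewrite cls_sym.
split; [exact: cls_reach (head_nthin yD) yz| |].
  by apply: cls_reach (head_nthin zD) _; rewrite cls_sym.
move: zD; rewrite inE => /andP[_ /existsP[x /andP[xz ns]]]; exists x => //.
by apply: contra ns => zx; apply: same_sig_reach => //; apply: reach_arc.
Qed.

Lemma card_cls_heads v : #|heads A T v| <= #|sources A T v|.
Proof.
have [->|[y yD]] := set_0Vmem (heads A T v); first by rewrite cards0.
have [le _] := card_heads ess (heads_mutual yD).
by move: yD le; rewrite inE => /andP[/cls_sources-> _].
Qed.

(** [v] reaches its whole class. A terminal of the class that reached [u] would close a cycle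
    through [(u, v)], and then the signatures would agree. *)
Lemma card_cls_entered u v : (u, v) \in A -> ~~ same_sig A T u v ->
  #|heads A T v| <= #|sources A T v :\: sources A T u|.+1 /\
  terminals v \subset sources A T v :\: sources A T u.
Proof.
move=> uv ns; have vD : v \in heads A T v.
  by rewrite inE cls_refl; apply/existsP; exists u; rewrite uv ns.
have nvu : ~~ reach A v u.
  by apply: contra ns => vu; apply: same_sig_reach => //; apply: reach_arc.
split; first by have [_] := card_heads ess (heads_mutual vD); apply.
apply/subsetP => z zt; rewrite inE (subsetP (terminals_sub v)) // andbT.
move: zt; rewrite !inE => /andP[vz zT]; rewrite zT /=; apply: contra nvu.
exact: reach_trans (cls_reach (head_nthin vD) vz).
Qed.

End Classes.

Lemma card_cls_tails A T v : essential A T -> #|tails A T v| <= #|targets A T v|.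
Proof.
move=> ess; rewrite -heads_rev -sources_rev.
exact: card_cls_heads (essential_rev ess) v.
Qed.

Lemma card_cls_left A T u v : essential A T -> (u, v) \in A -> ~~ same_sig A T u v ->
  #|tails A T u| <= #|targets A T u :\: targets A T v|.+1.
Proof.
move=> ess uv ns; rewrite -heads_rev -!sources_rev.
have [] := @card_cls_entered _ _ (essential_rev ess) v u.
- by rewrite mem_rev_arcs.
- by rewrite same_sig_rev same_sigC.
- by [].
Qed.

End Digraphs.

(** * Classes of vertices with the same sources and targets *)

Lemma steps_next (V : eqType) (x : V) p z :
  z \in x :: p -> z != last x p -> exists w, (z, w) \in steps (x :: p).
Proof.
elim: p x => [|y p IH] x; first by rewrite inE => /= ->.
rewrite inE => /orP[/eqP->|zp] nl; first by exists y; rewrite mem_head.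
by have [w zw] := IH y zp nl; exists w; rewrite /steps /= inE; apply/orP; right.
Qed.

Section ClassDecomposition.
Variables (V : finType) (A : {set V * V}) (T : {set V}).
Hypothesis Amin : forall A' : {set V * V}, A' \subset A ->
  {in T &, forall s t, reach A s t -> reach A' s t} -> A' = A.

Lemma minimal_essential : essential A T.
Proof.
move=> f fA; apply: NNPP => no; have := fA.
suff <- : A :\ f = A by rewrite !inE eqxx.
apply: Amin => [|s t sT tT st]; first exact: subsetDl.
by apply/negPn/negP => nst; apply: no; exists s, t.
Qed.
Let ess := minimal_essential.

Lemma minimal_loopless v : (v, v) \notin A.
Proof.
by apply/negP => /(essential_label ess)[s [t [_ sv _ /negP]]].
Qed.

Definition border v := heads A T v :|: terminals A T v :|: tails A T v.
Definition sig_class v := [set z | cls A T v z].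

Lemma border_sub v : border v \subset sig_class v.
Proof. by apply/subsetP => z; rewrite !inE => /orP[/orP[]|] /andP[]. Qed.

Lemma cls_eql u v : cls A T u v -> cls A T u =1 cls A T v.
Proof.
move=> uv z; apply/idP/idP; last exact: cls_trans.
by apply: cls_trans; rewrite cls_sym.
Qed.

Lemma border_cls u v : cls A T u v -> [/\ heads A T u = heads A T v,
  terminals A T u = terminals A T v, tails A T u = tails A T v,
  border u = border v & sig_class u = sig_class v].
Proof.
move=> uv; have E := cls_eql uv.
have h : heads A T u = heads A T v by apply/setP => z; rewrite !inE E.
have t : terminals A T u = terminals A T v by apply/setP => z; rewrite !inE E.
have l : tails A T u = tails A T v by apply/setP => z; rewrite !inE E.
by split=> //; [rewrite /border h t l|apply/setP => z; rewrite !inE E].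
Qed.

(** A strong component needs bags of [3 * #|border u| + 1] vertices, a path bags of 3; the width
    covers both. *)
Let goal u := tdec (3 * #|border u| + 3) (sig_class u) (fun X => X = border u \/
    exists a b, [/\ (a, b) \in A, cls A T u a, cls A T u b & X = [set a; b]]).

Let strong_class u : (forall a b, cls A T u a -> ~~ thin A T a b) -> goal u.
Proof.
move=> nthin; pose K := sig_class u.
have mutual x y : cls A T u x -> cls A T x y -> reach A x y /\ reach A y x.
  move=> ux; elim/connect_ind_r: y / => [|y z xy [yx1 yx2]]; first by split; apply: reach0.
  have uy := cls_trans ux xy.
  move=> /andP[yz s]; suff [zy1 zy2] : reach A y z /\ reach A z y.
    by split; [apply: reach_trans yx1 zy1|apply: reach_trans zy2 yx2].
  have uz : cls A T u z by apply: cls_trans uy _; apply: connect1; rewrite /cls_link yz.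
  case/orP: yz => [yz|zy].
    split; first exact: reach_arc.
    by apply: contraNT (nthin y z uy) => nzy; rewrite /thin yz s.
  split; last exact: reach_arc.
  by apply: contraNT (nthin z y uz) => nzy; rewrite /thin zy same_sigC s.
pose e : rel V := fun x y => [&& (x, y) \in A, x \in K & y \in K].
have Ke x y : e x y -> (x \in K) && (y \in K) by case/and3P => _ -> ->.
have Kc x y : x \in K -> y \in K -> connect e x y.
  rewrite !inE => ux uy; have xy : cls A T x y by apply: cls_trans uy; rewrite cls_sym.
  have [+ yx] := mutual _ _ ux xy.
  suff H z : reach A x z -> reach A z x -> cls A T u z /\ connect e x z.
    by move=> xy'; case: (H y).
  elim/connect_ind_r: z / => [|z w xz IH zw wx]; first by split.
  have [uz cz] := IH (reach_trans (reach_arc zw) wx).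
  have szw : cls A T z w.
    rewrite arc_cls //; apply: same_sig_reach; first exact: reach_arc.
    exact: reach_trans wx xz.
  have uw := cls_trans uz szw; split=> //; apply: connect_trans cz (connect1 _).
  by rewrite /e [_ \in A]zw !inE uz uw.
have [S [Se Sc dec]] := strongly_connected_tdec Kc Ke (border_sub u).
pose A' := [set f in A | ~~ ((f.1 \in K) && (f.2 \in K))] :|: S.
have inA' a b : (a, b) \in A -> ~~ ((a \in K) && (b \in K)) -> reach A' a b.
  by move=> ab nK; apply: reach_arc; rewrite in_setU in_set /= ab nK.
have SA' x y : x \in border u -> y \in border u -> reach A' x y.
  move=> xY yY; apply: connect_sub (Sc _ _ xY yY) => a b ab; apply: connect1.
  by rewrite /arc_rel in_setU [_ \in S]ab orbT.
have EA : A' = A.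
  apply: Amin.
    rewrite subUset; apply/andP; split; apply/subsetP => f; first by rewrite inE => /andP[].
    by case: f => a b /Se/and3P[].
  move=> s t sT tT.
  have bT z : z \in T -> z \in K -> z \in border u.
    by rewrite !inE => -> ->; rewrite orbT.
  have bnd a b : (a, b) \in A -> (a \in K) != (b \in K) ->
      if a \in K then a \in border u else b \in border u.
    move=> ab; have [aK|naK] := boolP (a \in K); have [bK|nbK] := boolP (b \in K) => // _.
      have ns : ~~ same_sig A T a b.
        rewrite -arc_cls //; apply: contra nbK => sab; move: aK; rewrite !inE => ua.
        exact: cls_trans ua sab.
      move: aK; rewrite !inE => ->; apply/orP; right; apply/existsP; exists b.
      by rewrite ab ns.
    have ns : ~~ same_sig A T a b.
      rewrite -arc_cls //; apply: contra naK => sab; move: bK; rewrite !inE => ub.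
      by apply: cls_trans ub _; rewrite cls_sym.
    move: bK; rewrite !inE => ->; apply/orP; left; apply/orP; left; apply/existsP; exists a.
    by rewrite ab ns.
  (* While the path runs inside the class, the invariant is that [A'] reaches every border vertex,
     so that it can follow wherever the path leaves. *)
  suff H v : reach A s v -> (v \notin K -> reach A' s v) /\
      (v \in K -> forall z, z \in border u -> reach A' s z).
    move=> /H[nK yK]; have [tK|/nK//] := boolP (t \in K); by apply: yK => //; apply: bT.
  elim/connect_ind_r: v / => [|v w _ [IHn IHk] vw].
    by split=> [_|sK z zY]; [apply: reach0|apply: SA' => //; apply: bT].
  have := bnd v w vw; have [vK|nvK] := boolP (v \in K); have [wK|nwK] := boolP (w \in K) => /=.
  - by move=> _; split=> // _; apply: IHk.
  - move=> /(_ isT) vY; split=> // _; apply: reach_trans (IHk vK _ vY) (inA' _ _ vw _).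
    by rewrite (negPf nwK) andbF.
  - move=> /(_ isT) wY; split=> // _ z zY.
    apply: reach_trans (IHn nvK) (reach_trans (inA' _ _ vw _) (SA' _ _ wY zY)).
    by rewrite (negPf nvK).
  - move=> _; split=> // _; apply: reach_trans (IHn nvK) (inA' _ _ vw _).
    by rewrite (negPf nvK).
apply: gdec_weaken dec => //; first by rewrite -addn1 leq_add2l.
move=> X [->|[a [b [ab ua ub ->]]]]; first by exists (border u) => //; left.
exists [set a; b] => //; right; exists (a, b) => //.
by move: ab; rewrite -EA in_setU !inE /= ua ub andbF.
Qed.

Let tail_nthin v y : y \in tails A T v -> forall x, ~~ thin A T y x.
Proof.
rewrite -heads_rev => yH x; rewrite -thin_rev.
exact: head_nthin (essential_rev ess) _ _ yH _.
Qed.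

Let thin_trivial a b w : thin A T a b ->
  (reach A a w -> reach A w a -> w = a) /\ (reach A b w -> reach A w b -> w = b).
Proof.
move=> tab; have /and3P[ab _ /negP nba] := tab; split=> aw wa; apply/eqP/negPn/negP => ne.
  have aw' : reach (rev_arcs A) w a by rewrite reach_rev.
  have [c] := reach_last aw' ne; rewrite reach_rev mem_rev_arcs => cw ac.
  by apply: nba; rewrite -(thin_out ess tab ac); apply: reach_trans cw wa.
have [c wc cb] := reach_last wa ne.
by apply: nba; rewrite -(thin_in ess tab cb); apply: reach_trans aw wc.
Qed.

(** The ends of a thin arc lie on no directed cycle, and this spreads along links, so all arcs
    inside the class are thin. A thin arc is the only one leaving its first vertex and the only one
    entering its second, which makes the class a directed path. *)
Let chain_class u a b : cls A T u a -> thin A T a b -> goal u.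
Proof.
move=> ua tab.
pose incident z := exists w, thin A T z w \/ thin A T w z.
have alone z w : incident z -> reach A z w -> reach A w z -> w = z.
  by case=> v [] /thin_trivial H; case: (H w).
have inc z : cls A T u z -> incident z.
  move=> uz; have : cls A T a z by apply: cls_trans uz; rewrite cls_sym.
  elim/connect_ind_r: z / {uz} => [|z w _ incz]; first by exists b; left.
  case/andP=> /orP[zw|wz] s.
    have [wz|nwz] := boolP (reach A w z).
      by rewrite (alone z w incz (reach_arc zw) wz).
    by exists z; right; rewrite /thin zw s.
  have [zw|nzw] := boolP (reach A z w).
    by rewrite (alone z w incz zw (reach_arc wz)).
  by exists z; left; rewrite /thin wz same_sigC s.
have thin_arc c d : (c, d) \in A -> cls A T u c -> cls A T u d -> thin A T c d.
  move=> cd uc ud; have ccd : cls A T c d by apply: cls_trans ud; rewrite cls_sym.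
  rewrite /thin cd (cls_same ccd); apply/negP => dc.
  have E := alone _ _ (inc _ uc) (reach_arc cd) dc.
  by have := minimal_loopless c; rewrite -{2}E cd.
have thin_cls c d : thin A T c d -> cls A T c d.
  by case/and3P => cd s _; rewrite arc_cls.
(* Take a vertex reaching the most vertices: a thin arc into it would start at a vertex reaching
   even more. *)
have [x [ux xin]] : exists x, cls A T u x /\ forall z, ~~ thin A T z x.
  have := @arg_maxnP _ a (cls A T u) (fun z => #|[set w | reach A z w]|) ua.
  case=> x ux xmax; exists x; split=> // z; apply/negP => tzx.
  have uz : cls A T u z by apply: cls_trans ux _; rewrite cls_sym; apply: thin_cls.
  have /and3P[zx _ nxz] := tzx; have : #|[set w | reach A z w]| <= #|[set w | reach A x w]| := xmax z uz.
  rewrite leqNgt => /negP; apply.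
  apply: proper_card; apply/properP; split.
    by apply/subsetP => w; rewrite !inE; apply: reach_trans (reach_arc zx).
  by exists z; rewrite !inE ?reach0.
have [y [uy yout]] : exists y, cls A T u y /\ forall z, ~~ thin A T y z.
  have := @arg_maxnP _ a (cls A T u) (fun z => #|[set w | reach A w z]|) ua.
  case=> y uy ymax; exists y; split=> // z; apply/negP => tyz.
  have uz : cls A T u z by apply: cls_trans uy _; apply: thin_cls.
  have /and3P[yz _ nzy] := tyz; have : #|[set w | reach A w z]| <= #|[set w | reach A w y]| := ymax z uz.
  rewrite leqNgt => /negP; apply.
  apply: proper_card; apply/properP; split.
    by apply/subsetP => w; rewrite !inE => wy; apply: reach_trans wy (reach_arc yz).
  by exists z; rewrite !inE ?reach0.
have from_x z : cls A T u z -> connect (thin A T) x z.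
  move=> uz; have : cls A T x z by apply: cls_trans uz; rewrite cls_sym.
  elim/connect_ind_r: z / {uz} => [|z w xz cz zw]; first exact: connect0.
  have uz := cls_trans ux xz; have uw := cls_trans uz (connect1 zw).
  case/andP: zw => /orP[zw|wz] s.
    exact: connect_trans cz (connect1 (thin_arc _ _ zw uz uw)).
  have twz := thin_arc _ _ wz uw uz.
  have [E|ne] := eqVneq x z; first by have := xin w; rewrite E twz.
  have [c xc /and3P[cz' _ _]] := connect_last cz ne.
  by rewrite -(thin_in ess twz cz').
have /connectP[p0 p0P y0] := from_x _ uy.
have [p [pP up Ey]] : exists p, [/\ path (thin A T) x p, uniq (x :: p) & y = last x p].
  by move: y0; case/shortenP: p0P => p pP up _ ->; exists p.
have next c d : c \in x :: p -> thin A T c d -> (c, d) \in steps (x :: p).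
  move=> cp tcd; have ne : c != last x p.
    by rewrite -Ey; apply/eqP => E; have := yout d; rewrite -E tcd.
  have [w cw] := steps_next cp ne; have := pP; rewrite path_steps => /allP/(_ _ cw).
  by case/and3P => /= cw' _ _; rewrite -(thin_out ess tcd cw').
have onp z : cls A T u z -> z \in x :: p.
  move=> /from_x; elim/connect_ind_r: z / => [|z w _ zp tzw]; first exact: mem_head.
  by case/andP: (mem_steps (next _ _ zp tzw)).
(* A vertex other than [x] is entered by a thin arc, so it is no head; one other than [y] is left by
   a thin arc, so it is no tail; and ends of thin arcs are not terminals. *)
have Ysub : border u \subset [set x; y].
  apply/subsetP => z zY; have := subsetP (border_sub u) _ zY; rewrite inE => uz.
  have nx : z != x -> exists w, thin A T w z.
    by rewrite eq_sym => /(connect_last (from_x _ uz))[w _ wz]; exists w.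
  have ny : z != y -> exists w, thin A T z w.
    rewrite Ey => /(steps_next (onp _ uz))[w zw]; exists w.
    by have := pP; rewrite path_steps => /allP/(_ _ zw).
  case/setUP: zY => [/setUP[zh|]|zt].
  - rewrite !inE; apply/orP; left; apply/negPn/negP => /nx[w wz].
    by have := head_nthin ess zh w; rewrite wz.
  - rewrite inE => /andP[_ zT]; have [w [] /thin_notin/andP[]] := inc _ uz.
      by rewrite zT.
    by move=> _; rewrite zT.
  - rewrite !inE; apply/orP; right; apply/negPn/negP => /ny[w zw].
    by have := tail_nthin zt w; rewrite zw.
apply: gdec_weaken (tdec_path up); first exact: leq_addl.
  apply/subsetP => z; rewrite in_set => zp; rewrite in_set; apply: cls_trans ux _.
  by rewrite /cls; apply: connect_sub (proj1 (path_connect_last pP zp)) => c d /thin_cls.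
move=> X [->|[c [d [cd uc ud ->]]]].
  by exists [set x; y]; [left; rewrite -Ey|].
exists [set c; d] => //; right; exists (c, d) => //.
by apply: next (onp _ uc) (thin_arc _ _ cd uc ud).
Qed.

Lemma cls_tdec u : tdec (3 * #|border u| + 3) (sig_class u) (fun X => X = border u \/
    exists a b, [/\ (a, b) \in A, cls A T u a, cls A T u b & X = [set a; b]]).
Proof.
have [[a [b [ua tab]]]|no] := classic (exists a b, cls A T u a /\ thin A T a b).
  exact: chain_class ua tab.
by apply: strong_class => a b ua; apply/negP => tab; apply: no; exists a, b.
Qed.

End ClassDecomposition.

(** * Counting along hops *)

Lemma count_rsplit (V : eqType) (P : pred V) (s : seq V) n : n.+1 <= count P s ->
  exists s1 a s2, [/\ s = s1 ++ a :: s2, P a & n <= count P s1].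
Proof.
elim/last_ind: s => // s a IH; rewrite -cats1 count_cat /= addn0.
case Pa: (P a) => cs.
  by exists s, a, [::]; rewrite cats1 -cats1 Pa; split=> //; rewrite addn1 in cs.
rewrite addn0 in cs; have [s1 [b [s2 [-> Pb le]]]] := IH cs.
by exists s1, b, (s2 ++ [:: a]); rewrite -catA.
Qed.

Lemma count_split (V : eqType) (P : pred V) (s : seq V) n : n.+2 <= count P s ->
  exists s1 a s2 b s3, [/\ s = s1 ++ a :: s2 ++ b :: s3, P a, P b & n <= size s2].
Proof.
move=> /count_rsplit[t [b [s3 [-> Pb cs]]]].
have : n.+1 <= count P (rev t) by rewrite count_rev.
case/count_rsplit => [t1 [a [t2 [Et Pa le]]]].
exists (rev t2), a, (rev t1), b, s3; rewrite size_rev (leq_trans le) ?count_size //.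
by split=> //; rewrite -[t]revK Et rev_cat rev_cons -cats1 -!catA.
Qed.

(** Any two vertices satisfying [P] are two steps apart through [z], whereas four of them on a path
    would include two at distance at least 3 along it. *)
Lemma shortest_path_count (V : finType) (J : rel V) r p (P : pred V) z :
  path J r p ->
  (forall p', path J r p' -> last r p' = last r p -> size p <= size p') ->
  (forall x, P x -> J x z && J z x) -> count P (r :: p) <= 3.
Proof.
move=> pP pmin Jz; rewrite leqNgt; apply/negP => /count_split[s1 [a [s2 [b [s3 [Es Pa Pb s2s]]]]]].
have [p' Ep'] : exists p', s1 ++ a :: z :: b :: s3 = r :: p'.
  by case: s1 Es => [|c s1] [<- _]; eexists.
have : path J r p'.
  have so : steps (r :: p) = steps (rcons s1 a) ++ steps (a :: rcons s2 b) ++ steps (b :: s3).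
    by rewrite Es steps_cat -cat_cons steps_cat rcons_cons.
  have sn : steps (r :: p') = steps (rcons s1 a) ++ [:: (a, z); (z, b)] ++ steps (b :: s3).
    by rewrite -Ep' steps_cat.
  move: pP; rewrite !path_steps so sn !all_cat => /and3P[-> _ ->] /=.
  by have /andP[-> _] := Jz a Pa; have /andP[_ ->] := Jz b Pb.
move/pmin; have -> : last r p' = last r p.
  have -> : last r p' = last r (r :: p') by [].
  have -> : last r p = last r (r :: p) by [].
  by rewrite -Ep' Es !last_cat /= last_cat.
move=> /(_ erefl); have := congr1 size Ep'; have := congr1 size Es.
rewrite /= !size_cat /= size_cat /=; move: s2s.
have ar (n n' k1 k2 k3 : nat) : 1 < k2 -> n.+1 = k1 + (k2 + k3.+1).+1 ->
  k1 + k3.+3 = n'.+1 -> n <= n' -> False by clear; lia.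
exact: ar.
Qed.

Section Costs.
Variables (V : finType) (e : rel V) (A : {set V * V}) (T : {set V}).
Hypotheses (e_sym : symmetric e) (Ae : forall u v, (u, v) \in A -> e u v).
Hypothesis ess : essential A T.

Let Y := border A T.
(** Charging both borders makes the weight symmetric, so that a walk along a directed path can be
    run backwards. *)
Definition class_weight u v := if cls A T u v then 0 else #|Y u| + #|Y v|.
Let yin v := #|heads A T v| + #|terminals A T v|.
Let yout v := #|tails A T v|.
Let src v := #|sources A T v|.
Let tgt v := #|targets A T v|.

Let YE v : #|Y v| <= yin v + yout v.
Proof.
apply: leq_trans (leq_card_setU _ _) _; rewrite leq_add2r.
exact: leq_card_setU.
Qed.

Let yin_le v : yin v <= 2 * src v.
Proof.
rewrite mul2n -addnn; apply: leq_add; first exact: card_cls_heads.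
exact/subset_leq_card/terminals_sub.
Qed.

Let yout_le v : yout v <= tgt v. Proof. exact: card_cls_tails. Qed.

Lemma card_border v : #|Y v| <= 3 * #|T|.
Proof.
have s : src v <= #|T| by apply/subset_leq_card/subsetP => z; rewrite inE => /andP[].
have t : tgt v <= #|T| by apply/subset_leq_card/subsetP => z; rewrite inE => /andP[].
have := YE v; have := yin_le v; have := yout_le v; move: s t; clear; lia.
Qed.

Lemma class_weight_sym u v : class_weight u v = class_weight v u.
Proof. by rewrite /class_weight cls_sym addnC. Qed.

(* Along an arc leaving a class, the bound on the number of heads of the class
   entered and of tails of the class left is paid for by new sources and lost
   targets, so the total telescopes. *)
Lemma reach_walk x y : reach A x y -> exists c n,
  walk e class_weight x y c n /\
  c + yin y + 8 * src x + 8 * tgt y <= yin x + 8 * src y + 8 * tgt x + yout y.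
Proof.
elim/connect_ind_r: y / => [|y z xy [c [n [xyw le]]] yz].
  by exists 0, 0; split; [apply: walk_nil|clear; lia].
exists (c + class_weight y z), n.+1; split; first exact: walk_rcons xyw (Ae yz).
have [s|ns] := boolP (same_sig A T y z).
  have yzc : cls A T y z by rewrite arc_cls.
  have [h t l _ _] := border_cls yzc.
  rewrite /class_weight yzc addn0 /yin /yout /src /tgt -h -t -l.
  by rewrite -(cls_sources yzc) -(cls_targets yzc).
rewrite /class_weight arc_cls // (negPf ns).
have [hz tz] := card_cls_entered ess yz ns.
have ly := card_cls_left ess yz ns.
have tz' := subset_leq_card tz.
have sE : src z = src y + #|sources A T z :\: sources A T y|.
  by rewrite /src -(cardsID (sources A T y)) (setIidPr (sources_sub T (reach_arc yz))).
have tE : tgt y = tgt z + #|targets A T y :\: targets A T z|.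
  by rewrite /tgt -(cardsID (targets A T z)) (setIidPr (targets_sub T (reach_arc yz))).
(* With a new sources and b lost targets, [yin z <= 2a + 1] and [yout y <= b + 1]. Each is charged
   twice, and [2(2a + 1) + 2(b + 1) <= 8(a + b)] because a + b is positive; this is the factor 8. *)
have pos : 0 < #|sources A T z :\: sources A T y| + #|targets A T y :\: targets A T z|.
  rewrite lt0n addn_eq0 !cards_eq0 !setD_eq0; apply: contra ns => /andP[s t].
  by rewrite /same_sig !eqEsubset s t (sources_sub T (reach_arc yz)) (targets_sub T (reach_arc yz)).
have Yy := YE y; have Yz := YE z.
move: le sE tE pos Yy Yz; rewrite /yin /yout.
move: hz tz' ly; clear.
move: #|heads A T z| #|heads A T y| #|terminals A T z| #|terminals A T y| #|tails A T y|
  #|tails A T z| #|_ :\: _| #|_ :\: _| #|Y y| #|Y z|.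
lia.
Qed.

Let val v := src v + tgt v.
Definition hop u v := [|| e u v, reach A u v | reach A v u].

Let hop_walk u v : hop u v -> exists c n,
  walk e class_weight u v c n /\ c <= 8 * (val u + val v).
Proof.
have rw x y : reach A x y -> exists c n,
    walk e class_weight x y c n /\ c <= 8 * (val x + val y).
  move=> /reach_walk[c [n [w le]]]; exists c, n; split=> //.
  have := yin_le x; have := yout_le y; move: le; rewrite /val; clear; lia.
case/or3P => [uv|/rw//|/rw[c [n [w le]]]].
  exists (class_weight u v), 1; split; first exact: walk1.
  rewrite /class_weight; case: ifP => _ //.
  have := YE u; have := YE v; have := yin_le u; have := yin_le v.
  have := yout_le u; have := yout_le v; rewrite /val; clear; lia.
exists c, n; split; last by rewrite addnC.
exact: walk_sym e_sym class_weight_sym w.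
Qed.

(** Exchanging the sums, each terminal counts at most 3 times as a source and 3 times as a
    target. *)
Let sum_val s : (forall z, count (reach A z) s <= 3) -> (forall z, count (reach A ^~ z) s <= 3) ->
  \sum_(x <- s) val x <= 6 * #|T|.
Proof.
move=> s1 s2; rewrite big_split /=.
have S x : src x = \sum_(z in T) (reach A z x : nat).
  by rewrite /src -sum1_card big_mkcond /= [RHS]big_mkcond; apply: eq_bigr => z _;
    rewrite inE; case: (z \in T); case: (reach A z x).
have L x : tgt x = \sum_(z in T) (reach A x z : nat).
  by rewrite /tgt -sum1_card big_mkcond /= [RHS]big_mkcond; apply: eq_bigr => z _;
    rewrite inE; case: (z \in T); case: (reach A x z).
have -> : 6 * #|T| = \sum_(z in T) 3 + \sum_(z in T) 3.
  by rewrite !sum_nat_const; clear; lia.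
apply: leq_add.
  rewrite (eq_bigr _ (fun x _ => S x)) exchange_big /=; apply: leq_sum => z _.
  apply: leq_trans (s1 z); rewrite -sum1_count [X in _ <= X]big_mkcond /=.
  by apply: leq_sum => x _; case: (reach A z x).
rewrite (eq_bigr _ (fun x _ => L x)) exchange_big /=; apply: leq_sum => z _.
apply: leq_trans (s2 z); rewrite -sum1_count [X in _ <= X]big_mkcond /=.
by apply: leq_sum => x _; case: (reach A x z).
Qed.

(* On a shortest sequence of hops a terminal is related to vertices at distance
   at most 2 only, so each terminal is charged a bounded number of times. *)
Lemma component_walk u v : connect e u v -> exists c n,
  walk e class_weight u v c n /\ c <= 96 * #|T|.
Proof.
move=> uv; have [p [pP Ep pmin]] : exists p, [/\ path hop u p, last u p = v &
    forall p', path hop u p' -> last u p' = v -> size p <= size p'].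
  have : connect hop u v.
    by apply: connect_sub uv => a b ab; apply: connect1; rewrite /hop ab.
  case/connectP => p0 p0P Ev.
  have [|n [p [pP Ep En]] nm] := @prop_least (fun n => exists p,
      [/\ path hop u p, last u p = v & size p = n]); first by exists (size p0), p0.
  by exists p; split=> // p' p'P Ep'; rewrite En; apply: nm; exists p'.
(* A hop costs at most 8 times the values of its ends, and each position ends at most two hops,
   hence 16, and [96 = 16 * 6]. The term [8 * val u] is reserved for a hop still to be prepended. *)
have [c [n [w le]]] : exists c n, walk e class_weight u v c n /\
    c + 8 * val u <= 16 * \sum_(x <- u :: p) val x.
  rewrite -Ep; elim: p {Ep pmin uv} u pP => [|x p IH] u /=.
    move=> _; exists 0, 0; rewrite big_seq1; split; first exact: walk_nil.
    by clear; lia.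
  case/andP=> /hop_walk[c1 [n1 [w1 le1]]] /IH[c2 [n2 [w2 le2]]].
  exists (c1 + c2), (n1 + n2); split; first exact: walk_cat w1 w2.
  by rewrite big_cons; move: le1 le2; clear; lia.
exists c, n; split=> //.
have : \sum_(x <- u :: p) val x <= 6 * #|T|.
  apply: sum_val => z; apply: (shortest_path_count pP (z := z)).
  - by move=> p' p'P E; apply: pmin => //; rewrite E.
  - by move=> x zx; rewrite /hop zx !orbT.
  - by move=> p' p'P E; apply: pmin => //; rewrite E.
  - by move=> x zx; rewrite /hop zx !orbT.
by move: le; clear; lia.
Qed.

End Costs.

(** * The treewidth bound *)

(** Minimality in terms of the terminals alone: a subset preserving all reachability among [T] still
    solves [r], and if it missed an arc, so would [A] without that arc. *)
Lemma minimal_solution_preserver (V : finType) (a r : rel V) (A : {set V * V}) (T : {set V}) :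
  (forall s t, r s t -> (s \in T) && (t \in T)) -> inclusion_minimal_solution a r A ->
  forall A' : {set V * V}, A' \subset A ->
    {in T &, forall s t, reach A s t -> reach A' s t} -> A' = A.
Proof.
move=> rT [_ Asol Amin] A' A'A pres; apply/eqP; rewrite eqEsubset A'A /=.
apply/subsetP => p pA; apply/negPn/negP => pA'; apply: (Amin p pA) => s t rst.
have /andP[sT tT] := rT s t rst.
apply: connect_sub (pres s t sT tT (Asol s t rst)) => u v uv; apply: connect1.
rewrite /arc_rel !inE [(u, v) \in A](subsetP A'A) // andbT.
by apply: contraNneq pA' => <-.
Qed.

Lemma und_edge_sym (V : finType) (a : rel V) : symmetric (und_edge a).
Proof. by move=> u v; rewrite /und_edge eq_sym orbC. Qed.

Lemma und_edge_irr (V : finType) (a : rel V) : irreflexive (und_edge a).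
Proof. by move=> u; rewrite /und_edge eqxx. Qed.

Section Assembly.
Variables (V : finType) (e : rel V) (g : nat) (rho : {perm (V * V)}).
Hypotheses (e_sym : symmetric e) (e_irr : irreflexive e).
Hypotheses (rhoP : rotation_system e rho) (genusP : rotation_genus e rho g).
Variables (A : {set V * V}) (T : {set V}).
Hypothesis Ae : forall u v, (u, v) \in A -> e u v.
Hypothesis Amin : forall A' : {set V * V}, A' \subset A ->
  {in T &, forall s t, reach A s t -> reach A' s t} -> A' = A.

Let ess := minimal_essential Amin.
Let Y := border A T.
Let class_arc u X := exists a b,
  [/\ (a, b) \in A, cls A T u a, cls A T u b & X = [set a; b]].

(** Three root paths per bag, each carrying at most [3 * #|T|] vertices for the border of its root
    and [96 * #|T|] for its cost. *)
Let core_width := 3 * (99 * #|T|) * (2 * g).+1.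

Let core : tdec core_width (\bigcup_v Y v)
  (fun S => exists u v, (u = v \/ e u v) /\ S = Y u :|: Y v).
Proof.
apply: (bounded_genus_tdec (rho := rho) (w := class_weight A T)) => //.
- move=> y u v yu yv; have cy z : y \in Y z -> cls A T z y.
    by move=> /(subsetP (border_sub A T z)); rewrite inE.
  have uv : cls A T u v by apply: cls_trans (cy _ yu) _; rewrite cls_sym cy.
  suff H z : cls A T u z -> connect (fun a b => [&& e a b, y \in Y a & y \in Y b]) u z.
    exact: H.
  elim/connect_ind_r: z / => [|a b ua IH ab]; first exact: connect0.
  have ub : cls A T u b := cls_trans ua (connect1 ab).
  have [_ _ _ Ea _] := border_cls ua; have [_ _ _ Eb _] := border_cls ub.
  apply: connect_trans IH (connect1 _); rewrite /Y -Ea -Eb; apply/and3P; split=> //.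
  by case/andP: ab => /orP[/Ae|/Ae] //; rewrite e_sym.
- move=> u v _; rewrite /class_weight; case: ifP => [uv|_].
    by have [_ _ _ E _] := border_cls uv; rewrite /Y E setDv cards0.
  by apply: leq_trans (subset_leq_card (subsetDl _ _)) (leq_addl _ _).
move=> v; have [|c [n [w le]]] := @component_walk _ e A T e_sym Ae ess (root e v) v.
  by rewrite sym_connect_sym // connect_root.
exists c, n; split=> //; apply: (@leq_trans (3 * #|T| + 96 * #|T|)).
  by apply: leq_add le; apply: card_border.
by rewrite -mulnDl.
Qed.

(** The last two summands bound the width of a single class, whose border has at most [3 * #|T|]
    vertices. *)
Let width := core_width + 9 * #|T| + 3.

(** Classes are attached one at a time, skipping those already present. What has been built meets a
    new class in its border only, since the core consists of borders and distinct classes are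
    disjoint. *)
Let glued (s : seq V) : exists2 U : {set V},
  U \subset (\bigcup_v Y v) :|: \bigcup_(u in s) sig_class A T u &
  tdec width U (fun X => (exists u v, (u = v \/ e u v) /\ X = Y u :|: Y v) \/
    exists2 u, u \in s & class_arc u X).
Proof.
elim: s => [|u s [U sU dU]].
  exists (\bigcup_v Y v); first exact: subsetUl.
  apply: gdec_weaken core => //; first by rewrite /width -addnA leq_addr.
  by move=> X [XF|[u]] //; exists X.
have [/hasP[u' us uu']|nu] := boolP (has (cls A T u) s).
  exists U.
    apply: subset_trans sU _; apply/setUS/bigcupsP => v vs.
    by apply: bigcup_sup; rewrite inE vs orbT.
  apply: gdec_weaken dU => // X [XF|[v]]; first by exists X => //; left.
  rewrite inE => /orP[/eqP->|vs] [a [b [ab ua ub EX]]]; exists X => //; right.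
    exists u' => //; exists a, b; split=> //; by rewrite -(cls_eql uu').
  by exists v => //; exists a, b.
have du := cls_tdec Amin u.
have {}du : tdec width (sig_class A T u) (fun X => X = Y u \/ class_arc u X).
  apply: gdec_weaken du => // [|X XF]; last by exists X.
  rewrite /width leq_add2r; apply: leq_trans (leq_addl _ _).
  by rewrite (_ : 9 = 3 * 3) // -mulnA leq_mul2l; apply: card_border.
have sub : U :&: sig_class A T u \subset Y u.
  apply/subsetP => z; rewrite inE => /andP[/(subsetP sU)].
  rewrite in_setU => /orP[/bigcupP[v _ zv]|/bigcupP[v vs zv]] zu.
    have vz : cls A T v z by have := subsetP (border_sub A T v) _ zv; rewrite inE.
    have uv : cls A T u v.
      by move: zu; rewrite inE => uz; apply: cls_trans uz _; rewrite cls_sym.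
    by have [_ _ _ E _] := border_cls uv; rewrite /Y E.
  case/negP: nu; apply/hasP; exists v => //; move: zu zv; rewrite !inE => uz vz.
  by apply: cls_trans uz _; rewrite cls_sym.
have := tdec_glue dU du (S1 := Y u) (S2 := Y u).
move=> /(_ _ _ sub sub) H; exists (U :|: sig_class A T u).
  rewrite subUset; apply/andP; split.
    apply: subset_trans sU _; apply/setUS/bigcupsP => v vs.
    by apply: bigcup_sup; rewrite inE vs orbT.
  by apply: subset_trans (subsetUr _ _); apply: bigcup_sup; rewrite inE eqxx.
apply: gdec_weaken (H _ _) => //.
- move=> X [XF|[v]]; first by exists X => //; left; left.
  rewrite inE => /orP[/eqP->|vs] XF; exists X => //; first by right; right.
  by left; right; exists v.
- by left; exists u, u; split; [left|rewrite setUid].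
- by left.
Qed.

(** An arc inside a class is covered by the decomposition of that class. An arc between classes
    joins a tail to a head, so [Y u :|: Y v] contains both ends, and the core has a bag for it
    because the arc is an edge of [e]. *)
Lemma minimal_preserver_treewidth : treewidth_at_most (und_edge (arc_rel A)) width.
Proof.
have [U _ dU] := glued (enum V).
apply: (@tdec_treewidth _ _ U _ _ (gdec_weaken (leqnSn _) (subxx _) (fun X FX => ex_intro2 _ _ X FX (subxx _)) dU)).
suff H u v : (u, v) \in A -> exists2 S : {set V}, (exists u v, (u = v \/ e u v) /\ S = Y u :|: Y v) \/
    (exists2 u, u \in enum V & class_arc u S) & [set u; v] \subset S.
  move=> u v /andP[_ /orP[/H //|/H[S FS vuS]]]; exists S => //.
  by rewrite setUC.
move=> uv; have [s|ns] := boolP (same_sig A T u v).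
  exists [set u; v] => //; right; exists u; first by rewrite mem_enum.
  by exists u, v; split=> //; [apply: cls_refl|rewrite arc_cls].
exists (Y u :|: Y v); first by left; exists u, v; split=> //; right; apply: Ae.
rewrite subUset !sub1set !inE; apply/andP; split.
  apply/orP; left; apply/orP; right.
  by rewrite cls_refl; apply/existsP; exists v; rewrite uv ns.
apply/orP; right; do 2![apply/orP; left].
by rewrite cls_refl; apply/existsP; exists u; rewrite uv ns.
Qed.

End Assembly.

Lemma treewidth_no_edge (V : finType) (e : rel V) : (forall u v, ~~ e u v) -> treewidth_at_most e 0.
Proof.
move=> ne; have := @tdec_bag V 1 set0 set0; rewrite cards0 => /(_ isT (subxx _)) d.
by apply: tdec_treewidth d _ => u v uv; have := ne u v; rewrite uv.
Qed.

Lemma treewidth_at_most_leq (V : finType) (e : rel V) k k' :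
  k <= k' -> treewidth_at_most e k -> treewidth_at_most e k'.
Proof.
move=> le [n [t [B [tB Bk]]]]; exists n, t, B; split=> // i.
exact: leq_trans (Bk i) _.
Qed.

Theorem theorem3 : exists c : nat,
  forall (V : finType) (a : rel V) (w : V -> V -> nat)
         (T : {set V}) (r : rel V) (A : {set V * V}) (g : nat),
    (forall u v, a u v -> 0 < w u v) ->
    (forall s t, r s t -> (s \in T) && (t \in T)) ->
    is_genus (und_edge a) g ->
    inclusion_minimal_solution a r A ->
    treewidth_at_most (und_edge (arc_rel A))
      (c * (20 ^ (4 * (4 * g + 3)) * maxn g 1 * #|T|)).
Proof.
(* With [m = maxn g 1] and q terminals, q positive, [2 * g + 1 <= 3 * m], so the width is at most
   [891 * q * m + 9 * q * m + 3 * q * m = 903 * q * m]. *)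
exists 1000 => V a w T r A g _ rT [[rho rhoP genusP] _] Amin.
have pres := minimal_solution_preserver rT Amin.
have ess := minimal_essential pres.
(* Without terminals the claimed bound is 0 and cannot absorb the additive 3; but then no arc has a
   label, so there are no arcs. *)
have [T0|Tpos] := posnP #|T|.
  rewrite T0 !muln0; apply: treewidth_no_edge => u v.
  have noA x y : (x, y) \notin A.
    apply/negP => /ess[s [t [+ _ _ _]]].
    by rewrite (cards0_eq T0) inE.
  by rewrite /und_edge /arc_rel (negPf (noA u v)) (negPf (noA v u)) andbF.
have Ae u v : (u, v) \in A -> und_edge a u v.
  move=> uv; case: Amin => /(_ _ uv) /= auv _ _; rewrite /und_edge auv andbT.
  by apply: contraTneq uv => ->; apply: minimal_loopless pres v.
have tw := minimal_preserver_treewidth (@und_edge_sym _ a) (@und_edge_irr _ a)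
  rhoP genusP Ae pres.
apply: treewidth_at_most_leq tw.
have : 0 < 20 ^ (4 * (4 * g + 3)) by rewrite expn_gt0.
move: Tpos; have : g <= maxn g 1 by exact: leq_maxl.
have : 0 < maxn g 1 by rewrite leq_max orbT.
move: #|T| (maxn g 1) (20 ^ _) => q m p; clear => m1 gm q1 p1.
apply: (@leq_trans (1000 * (m * q))); first by nia.
by rewrite leq_mul2l -mulnA leq_pmull.
Qed.
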